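(* Given a connected graph $G$, the numbers $\mathrm{vp}^-(G)$ and $\mathrm{vp}(G)$ can be computed in $O(n^4 \log(n))$ time, where $n = |V(G)|$.
   Context: All graphs are finite, undirected and simple. A $u,v$-geodesic is a shortest $u,v$-path. For a vertex $x$ of $G$, a set $S \subseteq V(G)$ is an $x$-position set if for every $y \in S$ no vertex of $S \setminus \{y\}$ lies on any $x,y$-geodesic in $G$. The $x$-position number $p_x(G)$ is the maximum cardinality of an $x$-position set of $G$. Define $\mathrm{vp}(G) = \max_{x \in V(G)} p_x(G)$ and $\mathrm{vp}^-(G) = \min_{x \in V(G)} p_x(G)$. *)

(* Defs.v *)
From HB Require Import structures.
From mathcomp Require Import all_boot all_order all_algebra.
From mathcomp Require Import all_classical all_reals all_analysis.

Set Implicit Arguments.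
Unset Strict Implicit.
Unset Printing Implicit Defensive.

Local Open Scope nat_scope.

(** * Graphs and vertex position numbers *)

Record sgraph := SGraph {
  vertex :> finType;
  adj : rel vertex;
  adj_sym : symmetric adj;
  adj_irr : irreflexive adj }.

Definition connected_graph (G : sgraph) : Prop :=
  0 < #|G| /\ forall u v : G, connect (@adj G) u v.

(* The vertex sequence of the path is [u :: p], its length is [size p]. *)
Definition is_path (G : sgraph) (u v : G) (p : seq G) : Prop :=
  [/\ path (@adj G) u p, last u p = v & uniq (u :: p)].

Definition geodesic (G : sgraph) (u v : G) (p : seq G) : Prop :=
  is_path u v p /\ forall q : seq G, is_path u v q -> size p <= size q.

Definition position_set (G : sgraph) (x : G) (S : {set G}) : Prop :=
  forall y, y \in S -> forall z, z \in S :\ y ->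
  forall p : seq G, geodesic x y p -> z \notin x :: p.

Definition pnum (G : sgraph) (x : G) : nat :=
  \max_(S : {set G} | `[< position_set x S >]) #|S|.

Definition vp (G : sgraph) : nat := \max_(x : G) pnum x.

(* Since [pnum x <= #|G|], the default value of the iterated minimum is
   irrelevant as soon as [G] has a vertex. *)
Definition vpm (G : sgraph) : nat := \big[minn/#|G|]_(x : G) pnum x.

(** * Word RAM

  Programs act on registers and on a memory with indirect addressing, both
  holding words of [w] bits.  Every literal, register access, memory access,
  arithmetic operation, comparison, assignment and branching test costs one
  time unit.  A computation that produces a value not fitting in a word has no
  result: it is stuck. *)

Inductive binop := Add | Sub | Mul | Eq | Lt.

Inductive expr :=
| Lit of nat
| Reg of nat
| Read of expr
| Bin of binop & expr & expr.

Inductive cmd :=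
| Skip
| SetReg of nat & expr              (* register := value *)
| Write of expr & expr              (* memory[address] := value *)
| Seq of cmd & cmd
| If of expr & cmd & cmd            (* a nonzero value means true *)
| While of expr & cmd.

Record state := State { regs : nat -> nat; mem : nat -> nat }.

Definition binop_eval (o : binop) (a b : nat) : nat :=
  match o with
  | Add => a + b
  | Sub => a - b
  | Mul => a * b
  | Eq => a == b
  | Lt => a < b
  end.

Definition word (w a : nat) : option nat :=
  if a < 2 ^ w then Some a else None.

Fixpoint eval (w : nat) (s : state) (e : expr) : option nat :=
  match e with
  | Lit a => word w a
  | Reg r => word w (regs s r)
  | Read e1 => obind (fun a => word w (mem s a)) (eval w s e1)
  | Bin o e1 e2 =>
      obind (fun a => obind (fun b => word w (binop_eval o a b))
                            (eval w s e2))
            (eval w s e1)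
  end.

Fixpoint cost (e : expr) : nat :=
  match e with
  | Lit _ | Reg _ => 1
  | Read e1 => (cost e1).+1
  | Bin _ e1 e2 => (cost e1 + cost e2).+1
  end.

Definition set_reg (s : state) (r v : nat) : state :=
  State [eta regs s with r |-> v] (mem s).

Definition set_mem (s : state) (a v : nat) : state :=
  State (regs s) [eta mem s with a |-> v].

(* [exec w c s t s']: with words of [w] bits, [c] started in the state [s]
   halts in the state [s'] after exactly [t] time units. *)
Inductive exec (w : nat) : cmd -> state -> nat -> state -> Prop :=
| ExecSkip s : exec w Skip s 1 s
| ExecSetReg r e s v : eval w s e = Some v ->
    exec w (SetReg r e) s (cost e).+1 (set_reg s r v)
| ExecWrite ea ev s a v : eval w s ea = Some a -> eval w s ev = Some v ->
    exec w (Write ea ev) s (cost ea + cost ev).+1 (set_mem s a v)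
| ExecSeq c1 c2 s1 s2 s3 t1 t2 : exec w c1 s1 t1 s2 -> exec w c2 s2 t2 s3 ->
    exec w (Seq c1 c2) s1 (t1 + t2) s3
| ExecIfTrue e c1 c2 s v t s' : eval w s e = Some v -> v != 0 ->
    exec w c1 s t s' -> exec w (If e c1 c2) s ((cost e).+1 + t) s'
| ExecIfFalse e c1 c2 s t s' : eval w s e = Some 0 ->
    exec w c2 s t s' -> exec w (If e c1 c2) s ((cost e).+1 + t) s'
| ExecWhileTrue e c s v t1 s1 t2 s2 : eval w s e = Some v -> v != 0 ->
    exec w c s t1 s1 -> exec w (While e c) s1 t2 s2 ->
    exec w (While e c) s ((cost e).+1 + t1 + t2) s2
| ExecWhileFalse e c s : eval w s e = Some 0 ->
    exec w (While e c) s (cost e).+1 s.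

Lemma exec_det w c s t1 s1 t2 s2 :
  exec w c s t1 s1 -> exec w c s t2 s2 -> t1 = t2 /\ s1 = s2.
Proof.
move=> H; elim: H t2 s2 => {c s t1 s1}; intros;
  match goal with H : exec _ _ _ ?t ?s |- _ = ?t /\ _ = ?s => inversion H end;
  subst;
  repeat match goal with
  | H1 : eval _ _ ?e = _, H2 : eval _ _ ?e = _ |- _ =>
      rewrite H2 in H1; case: H1 => ?; subst
  | IH : (forall t s, exec _ ?c ?s0 t s -> _ /\ _), H : exec _ ?c ?s0 _ _ |- _ =>
      case: (IH _ _ H) => ? ?; subst; clear H
  end; by [].
Qed.

(* Number of binary digits of [n]. *)
Definition bitlen (n : nat) : nat := (trunc_log 2 n).+1.

(* Row-major adjacency matrix of [G], with respect to the enumeration of its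
   vertices. *)
Definition adj_matrix (G : sgraph) (a : nat) : nat :=
  [exists u : G, exists v : G,
     (a == enum_rank u * #|G| + enum_rank v) && adj u v].

(* Register 0 contains the order of [G]; the memory contains its adjacency
   matrix; everything else is zero. *)
Definition input (G : sgraph) : state :=
  State [eta fun=> 0 with 0 |-> #|G|] (adj_matrix G).

(* One program [P] works for all connected graphs.  On graphs with [n]
   vertices the words have [k * bitlen n] bits, i.e. O(log n) bits.  The
   program returns [f1 G] and [f2 G] in the registers 0 and 1, in time at most
   [T n]. *)
Definition computes_on_connected (P : cmd) (k : nat) (T : nat -> nat)
    (f1 f2 : sgraph -> nat) : Prop :=
  forall G : sgraph, connected_graph G ->
  exists (t : nat) (s : state),
    [/\ exec (k * bitlen #|G|) P (input G) t s,
        t <= T #|G|, regs s 0 = f1 G & regs s 1 = f2 G].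

(* Main.v *)
From mathcomp Require Import all_boot zify boolp.
Require Import Defs.

(* Rooted at [x], the order "[y] lies on an [x,z]-geodesic" turns the
   [x]-position sets into antichains.  By Dilworth's theorem, in Koenig's form,
   the largest antichain has as many elements as a maximum matching of the
   strict order, viewed as a bipartite graph, leaves free.  Once all distances
   are known, each root costs at most [n] searches for an augmenting path, of
   [O(n^2)] operations each, hence [O(n^4)] operations in total.

   The algorithm only uses loops of [n] rounds, so that its running time is read
   off its syntax, and every value it stores exceeds the previous ones by at most
   one, so that words of [O(log n)] bits suffice. *)

Set Implicit Arguments.
Unset Strict Implicit.
Unset Printing Implicit Defensive.

Local Open Scope nat_scope.

(** * Bounded arithmetic on the word RAM *)

(** A computation that overflows has no result, so correctness cannot be separated from a bound on
    every intermediate value. Only the stored values are kept small by discipline; sums of two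
    distances and addresses of array cells occur inside expressions alone, where an exponent read
    off the syntax bounds them by a power of the largest stored value. The distances come from [n]
    rounds of relaxation over all triples of vertices, which costs no more than the matchings.
    Optimality of the final matching is not argued through its size: a failed search leaves a set of
    visited vertices that is Koenig's certificate, and a successful one lowers the number of free
    vertices by one. Hence a fixed number [n] of rounds ends with a certificate or without free
    vertices, and a search that follows a failure fails again. *)

Fixpoint ev (s : state) (e : expr) : nat :=
  match e with
  | Lit a => a
  | Reg r => regs s r
  | Read e1 => mem s (ev s e1)
  | Bin o e1 e2 => binop_eval o (ev s e1) (ev s e2)
  end.

(** An exponent for bounds of the form [M.+2 ^ esize e]: a product adds exponents, and a literal [a]
    gets [a.+1] because [a < 2 ^ a.+1]. *)
Fixpoint esize (e : expr) : nat :=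
  match e with
  | Lit a => a.+1
  | Reg _ => 1
  | Read e1 => (esize e1).+1
  | Bin _ e1 e2 => (esize e1 + esize e2).+1
  end.

Definition bounded (M : nat) (s : state) : Prop :=
  (forall r, regs s r <= M) /\ (forall a, mem s a <= M).

Lemma bounded_leq M M' s : M <= M' -> bounded M s -> bounded M' s.
Proof. by move=> le [br bm]; split=> i; apply: leq_trans le. Qed.

Lemma ev_bound M s e : bounded M s -> ev s e < M.+2 ^ esize e.
Proof.
move=> [br bm]; have M2 : 1 < M.+2 by [].
have ltX k : M < M.+2 ^ k.+1.
  by rewrite expnS (leq_trans _ (leq_pmulr _ _)) ?expn_gt0.
elim: e => [a|r|e _|o e1 IH1 e2 IH2] /=; try exact: leq_ltn_trans (ltX _).
  by apply: ltnW; rewrite ltn_expl.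
have pos k : 0 < M.+2 ^ k by rewrite expn_gt0.
rewrite expnS expnD.
move: IH1 IH2 (pos (esize e1)) (pos (esize e2)).
set A := _ ^ esize e1; set B := _ ^ esize e2.
move: (ev s e1) (ev s e2) => a b aA bB A0 B0.
(* Both factors are positive, so even a sum is at most [2 * (A * B)]; the successor in [esize]
   supplies the factor [M.+2], which absorbs the [2]. *)
have AB : A + B <= 2 * (A * B) by nia.
have AB2 : 2 * (A * B) <= M.+2 * (A * B) by rewrite leq_mul2r M2 orbT.
have AB1 : 0 < A * B by rewrite muln_gt0 A0.
apply: leq_trans AB2; case: o => /=.
- lia.
- lia.
- apply: leq_trans (_ : A * B <= _); first by apply: ltn_mul.
  by rewrite leq_pmull.
- by apply: leq_ltn_trans (leq_b1 _) _; lia.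
- by apply: leq_ltn_trans (leq_b1 _) _; lia.
Qed.

Lemma eval_ev w M s e :
  bounded M s -> M.+2 ^ esize e <= 2 ^ w -> eval w s e = Some (ev s e).
Proof.
move=> b; have wd e' : M.+2 ^ esize e' <= 2 ^ w ->
    word w (ev s e') = Some (ev s e').
  by move=> le; rewrite /word (leq_trans (ev_bound e' b) le).
have sub k e' : k <= esize e' -> M.+2 ^ esize e' <= 2 ^ w -> M.+2 ^ k <= 2 ^ w.
  by move=> ke; apply: leq_trans; rewrite leq_exp2l.
elim: e => [a|r|e IH|o e1 IH1 e2 IH2] /= le.
- exact: (wd (Lit a)).
- exact: (wd (Reg r)).
- rewrite IH /=; first exact: (wd (Read e)).
  by apply: sub (Read e) _ le => /=.
- rewrite IH1 /=; last by apply: sub (Bin o e1 e2) _ le => /=; lia.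
  rewrite IH2 /=; last by apply: sub (Bin o e1 e2) _ le => /=; lia.
  exact: (wd (Bin o e1 e2)).
Qed.

(** * A language of bounded loops *)

Inductive hexpr :=
| HLit of nat
| HN
| HVar of nat
| HInp of hexpr & hexpr
| HArr of nat & hexpr & hexpr
| HBin of binop & hexpr & hexpr.

Inductive hcmd :=
| HSkip
| HSet of nat & hexpr
| HStore of nat & hexpr & hexpr & hexpr
| HSeq of hcmd & hcmd
| HIf of hexpr & hcmd & hcmd
| HFor of nat & hcmd.

Record hstate := HState { hv : nat -> nat; ha : nat -> nat -> nat -> nat }.

Definition upd (f : nat -> nat) (i v : nat) : nat -> nat :=
  fun j => if j == i then v else f j.

Definition hset (s : hstate) (r v : nat) : hstate :=
  HState (upd (hv s) r v) (ha s).

Definition hstore (s : hstate) (a i j v : nat) : hstate :=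
  HState (hv s) (fun a' i' => if (a' == a) && (i' == i)
                              then upd (ha s a i) j v else ha s a' i').

Section Semantics.
Variables (n : nat) (inp : nat -> nat).

Fixpoint hev (s : hstate) (e : hexpr) : nat :=
  match e with
  | HLit a => a
  | HN => n
  | HVar r => hv s r
  | HInp e1 e2 => inp (hev s e1 * n + hev s e2)
  | HArr a e1 e2 => ha s a (hev s e1) (hev s e2)
  | HBin o e1 e2 => binop_eval o (hev s e1) (hev s e2)
  end.

(** A loop resets its counter in every round and leaves it at [n]. The compiled loop increments it
    instead; the two agree when the body never assigns the counter, as [slow_cmd] demands. *)
Fixpoint run (c : hcmd) (s : hstate) : hstate :=
  match c with
  | HSkip => s
  | HSet r e => hset s r (hev s e)
  | HStore a e1 e2 e => hstore s a (hev s e1) (hev s e2) (hev s e)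
  | HSeq c1 c2 => run c2 (run c1 s)
  | HIf e c1 c2 => if hev s e != 0 then run c1 s else run c2 s
  | HFor r c =>
      hset (foldl (fun s i => run c (hset s r i)) s (iota 0 n)) r n
  end.

End Semantics.

(** Syntactic footprints, decided by computation, so that the side conditions of the frame lemmas
    [run_hv] and [run_ha] vanish for concrete programs. *)
Fixpoint assigned (c : hcmd) : seq nat :=
  match c with
  | HSet r _ => [:: r]
  | HSeq c1 c2 | HIf _ c1 c2 => assigned c1 ++ assigned c2
  | HFor r c => r :: assigned c
  | _ => [::]
  end.

Fixpoint stored (c : hcmd) : seq nat :=
  match c with
  | HStore a _ _ _ => [:: a]
  | HSeq c1 c2 | HIf _ c1 c2 => stored c1 ++ stored c2
  | HFor _ c => stored c
  | _ => [::]
  end.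

Lemma run_hv n inp c s r :
  r \notin assigned c -> hv (run n inp c s) r = hv s r.
Proof.
elim: c s => [|r' e|a e1 e2 e|c1 IH1 c2 IH2|e c1 IH1 c2 IH2|r' c IH] s //=.
- by rewrite inE /upd => /negPf->.
- by rewrite mem_cat negb_or => /andP[h1 h2]; rewrite IH2 // IH1.
- by rewrite mem_cat negb_or => /andP[h1 h2]; case: ifP; rewrite ?IH1 ?IH2.
- rewrite inE negb_or /upd => /andP[/negPf rr' h]; rewrite rr'.
  elim: (iota 0 n) s => //= i l IHl s.
  by rewrite IHl IH //= /upd rr'.
Qed.

Lemma run_ha n inp c s a : a \notin stored c -> ha (run n inp c s) a = ha s a.
Proof.
elim: c s => [|r' e|a' e1 e2 e|c1 IH1 c2 IH2|e c1 IH1 c2 IH2|r' c IH] s //=.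
- by rewrite inE => /negPf->.
- by rewrite mem_cat negb_or => /andP[h1 h2]; rewrite IH2 // IH1.
- by rewrite mem_cat negb_or => /andP[h1 h2]; case: ifP; rewrite ?IH1 ?IH2.
- move=> h; elim: (iota 0 n) s => //= i l IHl s.
  by rewrite IHl IH.
Qed.

Lemma run_seq n inp c1 c2 s :
  run n inp (HSeq c1 c2) s = run n inp c2 (run n inp c1 s).
Proof. by []. Qed.

Lemma run_if n inp e c1 c2 s :
  run n inp (HIf e c1 c2) s =
  if hev n inp s e != 0 then run n inp c1 s else run n inp c2 s.
Proof. by []. Qed.

Lemma run_for n inp r c s (P : nat -> hstate -> Prop) :
  P 0 s ->
  (forall i s, i < n -> P i s -> P i.+1 (run n inp c (hset s r i))) ->
  (forall s, P n s -> P n (hset s r n)) ->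
  P n (run n inp (HFor r c) s).
Proof.
move=> P0 PS Pr /=; apply: (Pr).
have gen m i s' : i + m = n -> P i s' ->
    P n (foldl (fun s i => run n inp c (hset s r i)) s' (iota i m)).
  elim: m i s' => [|m IH] i s' /=; first by rewrite addn0 => ->.
  by move=> eqn Pi; apply: IH; rewrite ?addSnnS //; apply: PS => //; lia.
exact: gen.
Qed.

(** * Compilation to the word RAM *)

(* The map [(x, y) |-> (x + y) ^ 2 + x] is injective on pairs of integers, so
   that arrays of unknown size can share the memory. *)
Definition pairing (x y : nat) : nat := (x + y) * (x + y) + x.

(** Since [x <= x + y], the value lies between the square of [x + y] and the next square; it
    therefore determines the sum, and then [x]. *)
Lemma pairing_inj x y x' y' :
  pairing x y = pairing x' y' -> x = x' /\ y = y'.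
Proof.
rewrite /pairing => h.
case: (ltngtP (x + y) (x' + y')) => e.
- have : (x + y).+1 * (x + y).+1 <= (x' + y') * (x' + y') by apply: leq_mul.
  lia.
- have : (x' + y').+1 * (x' + y').+1 <= (x + y) * (x + y) by apply: leq_mul.
  lia.
- by move: h; rewrite e => /addnI ?; lia.
Qed.

Definition address (n a i j : nat) : nat :=
  n * n + pairing (pairing i j) a.

Definition pairing_expr (e1 e2 : expr) : expr :=
  Bin Add (Bin Mul (Bin Add e1 e2) (Bin Add e1 e2)) e1.

Definition address_expr (a : nat) (e1 e2 : expr) : expr :=
  Bin Add (Bin Mul (Reg 0) (Reg 0)) (pairing_expr (pairing_expr e1 e2) (Lit a)).

(** Registers are shifted because register 0 keeps the order. Beyond the matrix the memory holds the
    arrays, so an input read is multiplied by a range test: out of range it yields 0 on both sides,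
    which spares [ev_comp] any hypothesis on the indices. *)
Fixpoint comp_expr (e : hexpr) : expr :=
  match e with
  | HLit a => Lit a
  | HN => Reg 0
  | HVar r => Reg r.+1
  | HInp e1 e2 =>
      let p := Bin Add (Bin Mul (comp_expr e1) (Reg 0)) (comp_expr e2) in
      Bin Mul (Read p) (Bin Lt p (Bin Mul (Reg 0) (Reg 0)))
  | HArr a e1 e2 => Read (address_expr a (comp_expr e1) (comp_expr e2))
  | HBin o e1 e2 => Bin o (comp_expr e1) (comp_expr e2)
  end.

Fixpoint comp (c : hcmd) : cmd :=
  match c with
  | HSkip => Skip
  | HSet r e => SetReg r.+1 (comp_expr e)
  | HStore a e1 e2 e =>
      Write (address_expr a (comp_expr e1) (comp_expr e2)) (comp_expr e)
  | HSeq c1 c2 => Seq (comp c1) (comp c2)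
  | HIf e c1 c2 => If (comp_expr e) (comp c1) (comp c2)
  | HFor r c =>
      Seq (SetReg r.+1 (Lit 0))
          (While (Bin Lt (Reg r.+1) (Reg 0))
                 (Seq (comp c) (SetReg r.+1 (Bin Add (Reg r.+1) (Lit 1)))))
  end.

(** An upper bound that charges both branches of a test. In a loop, 2 is the initialization of the
    counter, 8 is one test and one increment, and 4 is the last test. *)
Fixpoint htime (n : nat) (c : hcmd) : nat :=
  match c with
  | HSkip => 1
  | HSet r e => (cost (comp_expr e)).+1
  | HStore a e1 e2 e =>
      (cost (address_expr a (comp_expr e1) (comp_expr e2))
       + cost (comp_expr e)).+1
  | HSeq c1 c2 => htime n c1 + htime n c2
  | HIf e c1 c2 => (cost (comp_expr e)).+1 + (htime n c1 + htime n c2)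
  | HFor r c => 2 + (n * (htime n c + 8) + 4)
  end.

Fixpoint hsize (c : hcmd) : nat :=
  match c with
  | HSkip => 0
  | HSet r e => esize (comp_expr e)
  | HStore a e1 e2 e =>
      esize (address_expr a (comp_expr e1) (comp_expr e2))
      + esize (comp_expr e)
  | HSeq c1 c2 => hsize c1 + hsize c2
  | HIf e c1 c2 => esize (comp_expr e) + (hsize c1 + hsize c2)
  | HFor r c => hsize c + 5
  end.

Fixpoint hdepth (c : hcmd) : nat :=
  match c with
  | HSeq c1 c2 | HIf _ c1 c2 => maxn (hdepth c1) (hdepth c2)
  | HFor r c => (hdepth c).+1
  | _ => 0
  end.

Definition atom (e : hexpr) : bool :=
  match e with
  | HLit a => a <= 1
  | HBin _ _ _ => false
  | _ => true
  end.

(* The value of such an expression exceeds the contents of the state by at most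
   one, hence the values computed by a program are bounded by its running time
   and words of logarithmic size are sufficient. *)
Definition slow (e : hexpr) : bool :=
  match e with
  | HBin Add e1 (HLit 1) => atom e1
  | HBin Sub e1 _ => atom e1
  | HBin Mul _ _ => false
  | HBin Add _ _ => false
  | HBin _ _ _ => true
  | _ => atom e
  end.

(** Only values that enter the state are restricted. Tests and array indices are free, since they
    cannot feed further growth and [hsize] accounts for them. *)
Fixpoint slow_cmd (c : hcmd) : bool :=
  match c with
  | HSkip => true
  | HSet _ e | HStore _ _ _ e => slow e
  | HSeq c1 c2 | HIf _ c1 c2 => slow_cmd c1 && slow_cmd c2
  | HFor r c => (r \notin assigned c) && slow_cmd c
  end.

Lemma htime_poly c : exists K, forall n, htime n c <= K * n.+1 ^ hdepth c.
Proof.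
have mono m m' K n : m <= m' -> K * n.+1 ^ m <= K * n.+1 ^ m'.
  by move=> le; rewrite leq_mul2l leq_pexp2l ?orbT.
elim: c => [|r e|a e1 e2 e|c1 [K1 IH1] c2 [K2 IH2]|e c1 [K1 IH1] c2 [K2 IH2]
           |r c [K IH]] /=.
- by exists 1.
- by eexists=> n; rewrite expn0 muln1.
- by eexists=> n; rewrite expn0 muln1.
- exists (K1 + K2) => n; rewrite mulnDl leq_add //.
    exact: leq_trans (IH1 n) (mono _ _ _ _ (leq_maxl _ _)).
  exact: leq_trans (IH2 n) (mono _ _ _ _ (leq_maxr _ _)).
- exists ((cost (comp_expr e)).+1 + (K1 + K2)) => n; rewrite mulnDl leq_add //.
    by rewrite leq_pmulr // expn_gt0.
  rewrite mulnDl leq_add //.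
    exact: leq_trans (IH1 n) (mono _ _ _ _ (leq_maxl _ _)).
  exact: leq_trans (IH2 n) (mono _ _ _ _ (leq_maxr _ _)).
- exists (K + 14) => n; move: (IH n); rewrite expnS.
  have : 0 < n.+1 ^ hdepth c by rewrite expn_gt0.
  move: (n.+1 ^ _) (htime n c) => A B A0 BA.
  have : n * B <= n * (K * A) by rewrite leq_mul2l BA orbT.
  nia.
Qed.

Section Simulation.
Variables (n w : nat) (inp : nat -> nat).
Hypothesis inp_out : forall p, n * n <= p -> inp p = 0.

Definition represents (rs : state) (s : hstate) : Prop :=
  [/\ regs rs 0 = n, forall r, regs rs r.+1 = hv s r,
      forall p, p < n * n -> mem rs p = inp p &
      forall a i j, mem rs (address n a i j) = ha s a i j].

Lemma ev_address rs s a e1 e2 : represents rs s ->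
  ev rs (address_expr a e1 e2) = address n a (ev rs e1) (ev rs e2).
Proof. by case=> r0 _ _ _ /=; rewrite r0. Qed.

Lemma ev_comp rs s e : represents rs s -> ev rs (comp_expr e) = hev n inp s e.
Proof.
move=> rep; have [r0 rr ri ra] := rep.
elim: e => [a||r|e1 IH1 e2 IH2|a e1 IH1 e2 IH2|o e1 IH1 e2 IH2].
- by [].
- by [].
- exact: rr.
- rewrite /= IH1 IH2 r0.
  case: ltnP => h; first by rewrite muln1 ri.
  by rewrite muln0 inp_out.
- change (mem rs (ev rs (address_expr a (comp_expr e1) (comp_expr e2))) =
    ha s a (hev n inp s e1) (hev n inp s e2)).
  by rewrite (ev_address _ _ _ rep) IH1 IH2 ra.
- by rewrite /= IH1 IH2.
Qed.

Lemma atom_bound rs s M e : represents rs s -> bounded M rs -> atom e ->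
  hev n inp s e <= maxn 1 M.
Proof.
move=> [r0 rr ri ra] [br bm]; rewrite leq_max.
case: e => [a||r|e1 e2|a e1 e2|//] /= h.
- by rewrite h.
- by rewrite -{2}r0 br orbT.
- by rewrite -rr br orbT.
- case: (ltnP (hev n inp s e1 * n + hev n inp s e2) (n * n)) => hp.
    by rewrite -ri // bm orbT.
  by rewrite inp_out.
- by rewrite -ra bm orbT.
Qed.

Lemma slow_bound rs s M e : 0 < M -> represents rs s -> bounded M rs -> slow e ->
  hev n inp s e <= M.+1.
Proof.
move=> M0 rep b; have at_le e' : atom e' -> hev n inp s e' <= M.
  by move=> h; have := atom_bound rep b h; rewrite (maxn_idPr M0).
case: e => [a||r|e1 e2|a e1 e2|o e1 e2] h; try exact/leqW/at_le.
case: o h => //= h.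
- case: e2 h => [[|[|a]]|||||] //= h; rewrite addn1 ltnS; exact: at_le.
- by apply: leq_trans (leq_subr _ _) _; apply/leqW/at_le.
- by apply: leq_trans (leq_b1 _) _.
- by apply: leq_trans (leq_b1 _) _.
Qed.

Lemma represents_set rs s r v : represents rs s ->
  represents (set_reg rs r.+1 v) (hset s r v).
Proof.
case=> r0 rr ri ra; split=> //= r'.
by rewrite /upd eqSS; case: ifP.
Qed.

Lemma bounded_set rs M r v : bounded M rs -> v <= M -> bounded M (set_reg rs r v).
Proof. by case=> br bm vM; split=> //= r'; case: ifP. Qed.

(** The bound on the state grows by at most one per assignment, hence by at most the time spent. One
    inequality, between the final bound raised to [hsize c] and the word size, thus excludes
    overflow throughout. *)
Lemma simulation c rs s M :
  slow_cmd c -> 0 < M -> represents rs s -> bounded M rs ->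
  (M + htime n c).+2 ^ hsize c <= 2 ^ w ->
  exists t rs', [/\ exec w (comp c) rs t rs', t <= htime n c,
    represents rs' (run n inp c s) & bounded (M + htime n c) rs'].
Proof.
elim: c rs s M => [|r e|a e1 e2 e|c1 IH1 c2 IH2|e c1 IH1 c2 IH2|r c IH] rs s M;
  rewrite [slow_cmd _]/= => sl M0 rep b le.
- exists 1, rs; split=> //; first exact: ExecSkip.
  by apply: bounded_leq b; rewrite leq_addr.
- have lee : M.+2 ^ esize (comp_expr e) <= 2 ^ w.
    by apply: leq_trans le; rewrite leq_exp2r //=; [lia|case: (e)].
  have evE := eval_ev b lee.
  exists (cost (comp_expr e)).+1, (set_reg rs r.+1 (ev rs (comp_expr e))).
  split=> //; first exact: ExecSetReg.
    by rewrite (ev_comp _ rep); apply: represents_set.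
  apply: bounded_set; first by apply: bounded_leq b; rewrite leq_addr.
  rewrite (ev_comp _ rep); apply: leq_trans (slow_bound M0 rep b sl) _.
  by rewrite /= addnS ltnS leq_addr.
- set ea := address_expr a (comp_expr e1) (comp_expr e2).
  have szM k : k <= hsize (HStore a e1 e2 e) -> M.+2 ^ k <= 2 ^ w.
    move=> hk; apply: leq_trans le.
    apply: leq_trans (_ : M.+2 ^ hsize (HStore a e1 e2 e) <= _).
      by rewrite leq_exp2l.
    by rewrite leq_exp2r //; rewrite ltnS ltnS leq_addr.
  have evA : eval w rs ea = Some (ev rs ea).
    by apply: eval_ev b _; apply: szM; rewrite leq_addr.
  have evE : eval w rs (comp_expr e) = Some (ev rs (comp_expr e)).
    by apply: eval_ev b _; apply: szM; rewrite leq_addl.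
  exists (cost ea + cost (comp_expr e)).+1,
    (set_mem rs (ev rs ea) (ev rs (comp_expr e))).
  split=> //; first exact: ExecWrite.
    rewrite (ev_comp _ rep) (ev_address _ _ _ rep) !(ev_comp _ rep).
    case: rep => r0 rr ri ra; split=> // [p hp|a' i' j'].
      rewrite [mem _ _]/= ifF ?ri //; apply/eqP => eqp.
      by move: hp; rewrite eqp /address ltnNge leq_addr.
    rewrite [mem _ _]/= ra [ha _ _ _ _]/=.
    have -> : (address n a' i' j' == address n a (hev n inp s e1) (hev n inp s e2))
      = [&& a' == a, i' == hev n inp s e1 & j' == hev n inp s e2].
      apply/eqP/and3P => [/addnI/pairing_inj[/pairing_inj[-> ->] ->] //|].
      by case=> /eqP-> /eqP-> /eqP->.
    case: (eqVneq a' a) => [->|/negPf ha']; last by rewrite /= ha'.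
    case: (eqVneq i' _) => [->|/negPf hi']; last by rewrite /= hi' andbF.
    by rewrite /= !eqxx /upd.
  case: b => br bm; split=> [r|p] /=.
    exact: leq_trans (br r) (leq_addr _ _).
  case: ifP => _; last exact: leq_trans (bm p) (leq_addr _ _).
  rewrite (ev_comp _ rep); apply: leq_trans (slow_bound M0 rep _ sl) _ => //.
  by rewrite addnS ltnS leq_addr.
- have /andP[sl1 sl2] := sl.
  have le' m k : m <= htime n c1 + htime n c2 -> k <= hsize c1 + hsize c2 ->
      (M + m).+2 ^ k <= 2 ^ w.
    move=> hm hk; apply: leq_trans le => /=.
    apply: leq_trans (_ : (M + m).+2 ^ (hsize c1 + hsize c2) <= _).
      by rewrite leq_exp2l.
    by case: (hsize c1 + _) => // k'; rewrite leq_exp2r // !ltnS leq_add2l.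
  have [|t1 [rs1 [ex1 lt1 rep1 b1]]] := IH1 rs s M sl1 M0 rep b.
    by apply: le'; rewrite leq_addr.
  have [||t2 [rs2 [ex2 lt2 rep2 b2]]] := IH2 rs1 _ (M + htime n c1) sl2 _ rep1 b1.
  + by rewrite addn_gt0 M0.
  + by rewrite -addnA; apply: le' => //; rewrite leq_addl.
  exists (t1 + t2), rs2; split=> //=.
  + exact: ExecSeq ex1 ex2.
  + exact: leq_add.
  + by rewrite addnA.
- have /andP[sl1 sl2] := sl.
  have le' m k : m <= htime n (HIf e c1 c2) -> k <= hsize (HIf e c1 c2) ->
      (M + m).+2 ^ k <= 2 ^ w.
    move=> hm hk; apply: leq_trans le.
    apply: leq_trans (_ : (M + m).+2 ^ (hsize (HIf e c1 c2)) <= _).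
      by rewrite leq_exp2l.
    by case: (hsize _) => // k'; rewrite leq_exp2r // !ltnS leq_add2l.
  have evE : eval w rs (comp_expr e) = Some (ev rs (comp_expr e)).
    apply: eval_ev b _; rewrite -[M]addn0; apply: le' => //=.
    by rewrite leq_addr.
  rewrite (ev_comp _ rep) in evE; rewrite [run _ _ _ _]/=.
  case: eqP evE => [-> | /eqP he] evE.
  + have [|t [rs' [ex lt rep' b']]] := IH2 rs s M sl2 M0 rep b.
      by apply: le' => /=; lia.
    exists ((cost (comp_expr e)).+1 + t), rs'; split=> //=.
    * exact: ExecIfFalse.
    * by rewrite leq_add2l (leq_trans lt) ?leq_addl.
    * by apply: bounded_leq b'; lia.
  + have [|t [rs' [ex lt rep' b']]] := IH1 rs s M sl1 M0 rep b.
      by apply: le' => /=; lia.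
    exists ((cost (comp_expr e)).+1 + t), rs'; split=> //=.
    * exact: ExecIfTrue evE he ex.
    * by rewrite leq_add2l (leq_trans lt) ?leq_addr.
    * by apply: bounded_leq b'; lia.
- have /andP[nr slc] := sl.
  have le' m k : m <= htime n (HFor r c) -> k <= hsize (HFor r c) ->
      (M + m).+2 ^ k <= 2 ^ w.
    move=> hm hk; apply: leq_trans le.
    apply: leq_trans (_ : (M + m).+2 ^ (hsize (HFor r c)) <= _).
      by rewrite leq_exp2l.
    by case: (hsize _) => // k'; rewrite leq_exp2r // !ltnS leq_add2l.
  pose body := While (Bin Lt (Reg r.+1) (Reg 0))
    (Seq (comp c) (SetReg r.+1 (Bin Add (Reg r.+1) (Lit 1)))).
  (* Here [i] rounds are over and [m] remain, and the counter already holds [i]. The bound charges 2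
     for the initialization and [htime n c + 8] for each past round. *)
  have loop m i rs1 s1 : i + m = n ->
      represents rs1 (hset s1 r i) -> bounded (M + 2 + i * (htime n c + 8)) rs1 ->
    exists t rs', [/\ exec w body rs1 t rs', t <= m * (htime n c + 8) + 4,
      represents rs'
        (hset (foldl (fun s i => run n inp c (hset s r i)) s1 (iota i m)) r n) &
      bounded (M + htime n (HFor r c)) rs'].
    elim: m i rs1 s1 => [|m IHm] i rs1 s1 im rep1 b1.
      have ei : i = n by lia.
      have test : eval w rs1 (Bin Lt (Reg r.+1) (Reg 0)) = Some 0.
        rewrite (eval_ev b1) /=; last first.
          by rewrite -addnA; apply: le' => /=; [rewrite ei; lia|lia].
        by case: rep1 => -> -> _ _ /=; rewrite /upd eqxx ei ltnn.
      exists 4, rs1; split=> //=; first exact: ExecWhileFalse test.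
        by rewrite -ei.
      by apply: bounded_leq b1; rewrite ei; lia.
    have lin : i < n by lia.
    have hi : (i.+1) * (htime n c + 8) <= n * (htime n c + 8).
      by rewrite leq_mul2r lin orbT.
    have test : eval w rs1 (Bin Lt (Reg r.+1) (Reg 0)) = Some 1.
      rewrite (eval_ev b1) /=; last first.
        by rewrite -addnA; apply: le' => /=; lia.
      by case: rep1 => -> -> _ _ /=; rewrite /upd eqxx lin.
    have [||t [rs2 [ex2 lt2 rep2 b2]]] := IH rs1 _ _ slc _ rep1 b1.
    + lia.
    + by rewrite -2!addnA; apply: le' => /=; lia.
    have vr : hv (run n inp c (hset s1 r i)) r = i.
      by rewrite run_hv //= /upd eqxx.
    have incr : eval w rs2 (Bin Add (Reg r.+1) (Lit 1)) = Some i.+1.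
      rewrite (eval_ev b2) /=; last first.
        by rewrite -2!addnA; apply: le' => /=; lia.
      by case: rep2 => _ -> _ _; rewrite vr addn1.
    have [|||t3 [rs3 [ex3 lt3 rep3 b3]]] := IHm i.+1 (set_reg rs2 r.+1 i.+1)
        (run n inp c (hset s1 r i)).
    + lia.
    + exact: represents_set.
    + apply: bounded_set; first by apply: bounded_leq b2; lia.
      by nia.
    exists (4 + (t + 4) + t3), rs3; split=> //; last by lia.
    apply: ExecWhileTrue test _ _ ex3 => //.
    exact: ExecSeq ex2 (ExecSetReg _ incr).
  have init : eval w rs (Lit 0) = Some 0.
    by apply: (eval_ev b (e := Lit 0)); rewrite -[M]addn0; apply: le' => /=; lia.
  have [|||t [rs' [ex lt rep' b']]] := loop n 0 (set_reg rs r.+1 0) s.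
  + by [].
  + exact: represents_set.
  + by apply: bounded_set => //; apply: bounded_leq b; lia.
  exists (2 + t), rs'; split=> //.
    exact: ExecSeq (ExecSetReg _ init) ex.
Qed.

End Simulation.

Arguments upd f i v j /.
Arguments run : simpl nomatch.

(** * Antichains and matchings *)

Section Antichain.
Variables (T : finType) (lt : rel T) (m : T -> option T).
Hypothesis lt_trans : transitive lt.
Hypothesis m_lt : forall y z, m y = Some z -> lt y z.
Hypothesis m_inj : forall y1 y2 z, m y1 = Some z -> m y2 = Some z -> y1 = y2.

Definition antichain (A : {set T}) : Prop :=
  forall y z, y \in A -> z \in A -> ~~ lt y z.

(* The matching injects the matched elements of the up-set generated by [A]
   into this up-set deprived of [A]. *)
Lemma antichain_card_le (A : {set T}) :
  antichain A -> #|A| <= #|[set y | m y == None]|.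
Proof.
move=> anti.
pose U := [set v | (v \in A) || [exists a in A, lt a v]].
pose N := [set y | m y == None].
pose f y := odflt y (m y).
have AU : A \subset U by apply/subsetP=> v vA; rewrite inE vA.
have f_inj : {in U :\: N &, injective f}.
  move=> y1 y2; rewrite !in_setD !inE /f => /andP[m1 _] /andP[m2 _].
  case e1: (m y1) m1 => [z1|] // _; case e2: (m y2) m2 => [z2|] // _ /= z12.
  by apply: m_inj e1 _; rewrite z12.
have fU : f @: (U :\: N) \subset U :\: A.
  apply/subsetP=> _ /imsetP[y yUN ->]; move: yUN; rewrite !inE /f => /andP[].
  case e: (m y) => [z|] // _ yU /=; have yz := m_lt e.
  have [a aA az] : exists2 a, a \in A & lt a z.
    case/orP: yU => [yA|/exists_inP[a aA ay]]; first by exists y.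
    by exists a => //; apply: lt_trans yz.
  apply/andP; split.
    by apply/negP=> zA; case/negP: (anti a z aA zA).
  by apply/orP; right; apply/exists_inP; exists a.
have := subset_leq_card fU; rewrite (card_in_imset f_inj) => le.
have := cardsID A U; rewrite (setIidPr AU) => cA.
have := cardsID N U => cN.
have : #|U :&: N| <= #|N| by rewrite subset_leq_card ?subsetIr.
by rewrite -/N; lia.
Qed.

(* Koenig's certificate: [vis] contains the right ends of the alternating
   paths issued from the unmatched elements. *)
Lemma antichain_of_certificate (vis : {set T}) :
  let reached := [set y | if m y is Some z then z \in vis else true] in
  (forall y z, y \in reached -> lt y z -> z \in vis) ->
  (forall z, z \in vis -> exists y, m y = Some z) ->
  exists2 A, antichain A & #|[set y | m y == None]| <= #|A|.
Proof.
(* Each element of [vis] is the partner of a matched element of [reached], so [vis] is no larger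
   than the matched part of [reached]; removing it leaves at least as many elements as are free. *)
move=> reached closed matched; exists (reached :\: vis).
  move=> y z; rewrite !inE => /andP[_ yr] /andP[zv _].
  by apply/negP=> /closed-/(_ _); rewrite inE yr (negPf zv) => /(_ isT).
pose N := [set y | m y == None].
have NR : N \subset reached.
  by apply/subsetP=> y; rewrite !inE => /eqP->.
have [g gP] : exists g : T -> T, forall z, z \in vis -> m (g z) = Some z.
  have /choice[g gP] : forall z, exists y, z \in vis -> m y = Some z.
    by move=> z; case: (boolP (z \in vis)) => [/matched[y]|]; [exists y|exists z].
  by exists g.
have ginj : {in vis &, injective g}.
  by move=> z1 z2 /gP e1 /gP e2 e; move: e1; rewrite e e2 => -[].
have gR : g @: vis \subset reached :\: N.
  apply/subsetP=> _ /imsetP[z zv ->]; rewrite !inE.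
  by rewrite (gP _ zv).
have := subset_leq_card gR; rewrite (card_in_imset ginj) => le.
have := cardsID N reached; rewrite (setIidPr NR) => cN.
have := cardsID vis reached => cv.
have : #|reached :&: vis| <= #|vis| by rewrite subset_leq_card ?subsetIr.
by rewrite -/N; lia.
Qed.

End Antichain.

(** * Position sets as antichains *)

Section Distance.
Variables (G : sgraph) (d : G -> G -> nat).

(** Phrased with walks, which can be concatenated without a check for repetitions; [geodesicP]
    returns to simple paths. *)
Definition distance_spec : Prop :=
  (forall u v : G, exists p, [/\ path (@adj G) u p, last u p = v & size p = d u v])
  /\ (forall (u : G) p, path (@adj G) u p -> d u (last u p) <= size p).

Hypothesis dP : distance_spec.

Lemma dist_triangle u v w : d u w <= d u v + d v w.
Proof.
have [ex le] := dP; have [p [pp lp sp]] := ex u v; have [q [pq lq sq]] := ex v w.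
have := le u (p ++ q); rewrite cat_path pp lp pq last_cat lp lq size_cat sp sq.
exact.
Qed.

Lemma dist_eq0 u v : d u v = 0 -> u = v.
Proof.
have [ex _] := dP; have [p [_ lp sp]] := ex u v => d0.
by move: sp lp; rewrite d0 => /eqP; rewrite size_eq0 => /eqP->.
Qed.

Lemma shortened (u : G) p : path (@adj G) u p ->
  exists q, [/\ path (@adj G) u q, last u q = last u p, uniq (u :: q) &
    {subset q <= p}].
Proof. by case/shortenP=> q pq uq sub; exists q. Qed.

(** A shortest walk is simple: cutting out a repetition would make it shorter than [d u v]. *)
Lemma geodesicP u v p :
  geodesic u v p <-> [/\ path (@adj G) u p, last u p = v & size p = d u v].
Proof.
have [ex le] := dP; split=> [[[pp lp up] min]|[pp lp sp]].
  split=> //; apply/eqP; rewrite eqn_leq -{2}lp le // andbT.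
  have [q [pq lq <-]] := ex u v.
  have [q' [pq' lq' uq' sub]] := shortened pq.
  apply: leq_trans (min q' _) (uniq_leq_size _ sub); last by case/andP: uq'.
  by split=> //; rewrite lq'.
split=> [|q [pq lq uq]]; last by rewrite sp -lq; apply: le.
split=> //; have [q [pq lq uq sub]] := shortened pp.
apply: leq_size_uniq uq _ _ => [y|]; last by rewrite /= ltnS sp -lp -lq le.
by rewrite !inE => /orP[->|/sub->] //; rewrite orbT.
Qed.

Definition before (x : G) : rel G :=
  fun y z => (y != z) && (d x y + d y z == d x z).

Lemma before_trans x : transitive (before x).
Proof.
move=> b a c /andP[ab /eqP e1] /andP[bc /eqP e2]; apply/andP; split.
  apply: contraNneq ab => ac; apply/eqP/dist_eq0; subst c.
  by have := dist_triangle x a b; lia.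
have := dist_triangle x a c; have := dist_triangle a b c.
by move=> h1 h2; apply/eqP; lia.
Qed.

(** A vertex lies on some geodesic exactly when the triangle inequality through it is an equality.
    The root fits in: it lies on all geodesics from [x] and precedes every other vertex. *)
Lemma position_set_antichain x (S : {set G}) :
  position_set x S <-> antichain (before x) S.
Proof.
have [ex le] := dP; split=> [pos y z yS zS|anti y yS z].
  apply/negP=> /andP[nyz /eqP e].
  have [p [pp lp sp]] := ex x y; have [q [pq lq sq]] := ex y z.
  have g : geodesic x z (p ++ q).
    by apply/geodesicP; rewrite cat_path pp lp pq last_cat lp lq size_cat sp sq.
  have yS' : y \in S :\ z by rewrite !inE nyz.
  have := pos z zS y yS' _ g; rewrite -cat_cons mem_cat negb_or => /andP[].
  by rewrite -lp mem_last.
rewrite !inE => /andP[nzy zS] p /geodesicP[pp lp sp]; apply/negP=> zp.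
case/negP: (anti z y zS yS); rewrite /before nzy /=.
have [p1 [p2 [pE lp1]]] : exists p1 p2, p = p1 ++ p2 /\ last x p1 = z.
  move: zp; case/splitPl=> p1 p2 e; by exists p1, p2.
move: pp lp sp; rewrite pE cat_path last_cat size_cat lp1 => /andP[pp1 pp2] lp sp.
have h1 := le x p1 pp1; have h2 := le z p2 pp2; rewrite lp1 in h1; rewrite lp in h2.
have := dist_triangle x z y; move=> h3; apply/eqP; lia.
Qed.

Lemma pnum_unique x N (A : {set G}) :
  (forall S, antichain (before x) S -> #|S| <= N) ->
  antichain (before x) A -> N <= #|A| -> pnum x = N.
Proof.
move=> ub aA le; apply/eqP; rewrite eqn_leq; apply/andP; split.
  by apply/bigmax_leqP=> S /asboolP/position_set_antichain; apply: ub.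
apply: leq_trans le _; rewrite /pnum; apply: bigmax_sup (leqnn _).
by apply/asboolP/position_set_antichain.
Qed.

End Distance.

(** The default value of the iterated minimum becomes the conjunct [m <= #|G|]; the program starts
    its minimum from the same value. *)
Lemma leq_vpm (G : sgraph) m :
  (m <= vpm G) = (m <= #|G|) && [forall x : G, m <= pnum x].
Proof.
have -> : [forall x : G, m <= pnum x] =
    all (fun x : G => m <= pnum x) (index_enum G).
  apply/forallP/allP => [h x _|h x]; [exact: h|by apply: h; rewrite mem_index_enum].
rewrite /vpm; elim: (index_enum G) => [|x s IH] /=.
  by rewrite big_nil andbT.
by rewrite big_cons leq_min IH andbCA.
Qed.

Lemma vp_leq (G : sgraph) m : (vp G <= m) = [forall x : G, pnum x <= m].
Proof.
by apply/bigmax_leqP/forallP => [h x|h x _]; apply: h.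
Qed.

(** * Augmenting paths *)

Lemma count_upd n (f : nat -> nat) (p : pred nat) i v : i < n ->
  count (fun j => p (upd f i v j)) (iota 0 n) + p (f i)
  = count (fun j => p (f j)) (iota 0 n) + p v.
Proof.
move=> lt; have -> : iota 0 n = iota 0 i ++ i :: iota i.+1 (n - i.+1).
  by rewrite -[in LHS](subnKC (ltnW lt)) iotaD add0n -(subnSK lt).
have out l : i \notin l ->
    count (fun j => p (upd f i v j)) l = count (fun j => p (f j)) l.
  by move=> il; apply: eq_in_count => j jl /=; case: eqP il jl => // -> /negP.
rewrite !count_cat /= eqxx !out; first by lia.
  by rewrite mem_iota; lia.
by rewrite mem_iota; lia.
Qed.

Section Matching.
Variables (n : nat) (lt : rel nat).
Implicit Types ml mr pr dn : nat -> nat.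

(* Partners are shifted by one: [ml y = z.+1] when [y] is matched to [z], and
   [ml y = 0] when [y] is free. *)
Definition matching ml mr : Prop :=
  (forall y z, y < n -> ml y = z.+1 -> [/\ z < n, lt y z & mr z = y.+1]) /\
  (forall y z, z < n -> mr z = y.+1 -> y < n /\ ml y = z.+1).

Definition nfree ml := count (fun y => ml y == 0) (iota 0 n).

Definition nvisited pr := count (fun z => 0 < pr z) (iota 0 n).

Definition reached ml pr y := (ml y == 0) || (0 < pr (ml y).-1).

(* An alternating path of [k] matched edges from a free left vertex to the
   right vertex [z], read backwards along the predecessors [pr]. *)
Fixpoint alternating pr ml k z : Prop :=
  exists y, [/\ z < n, y < n, pr z = y.+1, lt y z &
    if k is k'.+1 then exists2 z', ml y = z'.+1 & alternating pr ml k' z'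
    else ml y = 0].

Definition found_spec mr pr f : Prop :=
  if f is z.+1 then [/\ z < n, 0 < pr z & mr z = 0]
  else forall z, z < n -> 0 < pr z -> 0 < mr z.

(* The neighbours [z] of the processed vertices are visited, except that [y0]
   is being processed and has been compared with [z < j] only. *)
Definition search_inv y0 j ml mr pr dn f : Prop :=
  [/\ forall z, z < n -> 0 < pr z ->
        exists2 k, k < nvisited pr & alternating pr ml k z,
      forall y z, y < n -> z < n -> 0 < dn y -> (y != y0) || (z < j) ->
        lt y z -> 0 < pr z
    & found_spec mr pr f].

(** The outcome of a failed search, in the shape that [antichain_of_certificate] expects: right
    vertices closed under alternation, all of them matched. No augmenting path can leave such a set,
    see [stuck_alternating]. *)
Definition stuck ml mr : Prop :=
  exists pr, (forall y z, y < n -> z < n -> reached ml pr y -> lt y z -> 0 < pr z)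
    /\ (forall z, z < n -> 0 < pr z -> 0 < mr z).

Lemma alternating_visit pr ml k z j y :
  pr j = 0 -> alternating pr ml k z -> alternating (upd pr j y) ml k z.
Proof.
move=> prj; elim: k z => [|k IH] z [y' [zn yn pz yz]] my; exists y'; split=> //=.
- by case: eqP pz => [->|//]; rewrite prj.
- by case: eqP pz => [->|//]; rewrite prj.
- by case: my => z' mz a; exists z' => //; apply: IH.
Qed.

(** The predecessors and partners determine the whole path, so its length is a function of its end.
    This replaces an explicit proof that augmenting paths are simple. *)
Lemma alternating_det pr ml k k' z :
  alternating pr ml k z -> alternating pr ml k' z -> k = k'.
Proof.
elim: k k' z => [|k IH] [|k'] z //= [y [_ _ -> _ my]] [_ [_ _ [<-] _]];
  rewrite ?my.
- by case.
- by case: my => z' ->.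
- by case: my => z' -> a [_ [<-] a']; congr _.+1; apply: IH a a'.
Qed.

(** A path through [y0] continues from there exactly as the path from [z0] does. Were it shorter
    than that path, [z0] would end paths of two different lengths. *)
Lemma alternating_flip pr ml k k0 z z0 y0 v :
  alternating pr ml k0 z0 -> pr z0 = y0.+1 ->
  alternating pr ml k z -> k < k0 -> alternating pr (upd ml y0 v) k z.
Proof.
move=> a0 p0.
have ne k1 z1 y : alternating pr ml k1 z1 -> pr z1 = y.+1 -> k1 < k0 -> y != y0.
  move=> a1 pz; apply: contraTneq => e; subst y.
  suff a : alternating pr ml k1 z0 by rewrite (alternating_det a a0) ltnn.
  have [zn l] : z0 < n /\ lt y0 z0.
    by case: (k0) a0 => [|k2] [y [? ? + ? _]]; rewrite p0 => -[->].
  by case: k1 a1 => [|k2] [y [_ yn + _ my]]; rewrite pz => -[e]; subst y;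
    exists y0; split.
elim: k z => [|k IH] z a kk0; have [y [zn yn pz yz my]] := a;
  exists y; split=> //; rewrite /= (negPf (ne _ _ _ a pz kk0)) //.
by case: my => z' my a'; exists z' => //; apply: IH => //; apply: ltnW.
Qed.

Lemma stuck_alternating ml mr pr k z :
  stuck ml mr -> alternating pr ml k z -> 0 < mr z.
Proof.
case=> vis [closed matched] a.
suff : z < n /\ 0 < vis z by case=> zn /matched; apply.
elim: k z a => [|k IH] z [y [zn yn _ yz my]]; split=> //; apply: closed yn zn _ yz.
  by rewrite /reached my.
by case: my => z' my /IH[_ h]; rewrite /reached my /= h.
Qed.

Lemma search_inv0 y0 j ml mr pr dn :
  (forall z, z < n -> pr z = 0) -> (forall y, y < n -> dn y = 0) ->
  search_inv y0 j ml mr pr dn 0.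
Proof.
move=> p0 d0; split=> [z zn|y z yn zn|z zn].
- by rewrite p0.
- by rewrite d0.
- by rewrite p0.
Qed.

Lemma search_inv_process y0 y1 ml mr pr dn f v :
  search_inv y1 n ml mr pr dn f -> search_inv y0 0 ml mr pr (upd dn y0 v) f.
Proof.
case=> h1 h2 h3; split=> // y z yn zn /=; case: eqP => //= _ dy _.
by apply: h2; rewrite ?zn ?orbT.
Qed.

Lemma search_inv_done y0 y1 ml mr pr dn f :
  search_inv y0 n ml mr pr dn f -> search_inv y1 n ml mr pr dn f.
Proof.
case=> h1 h2 h3; split=> // y z yn zn dy _.
by apply: h2; rewrite ?zn ?orbT.
Qed.

Lemma search_inv_skip y0 j ml mr pr dn f :
  ~~ lt y0 j || (0 < pr j) ->
  search_inv y0 j ml mr pr dn f -> search_inv y0 j.+1 ml mr pr dn f.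
Proof.
move=> skip [h1 h2 h3]; split=> // y z yn zn dy.
case: (eqVneq z j) => [e|zj].
  case: (eqVneq y y0) => [-> _|yy0 _].
    by move=> l; move: skip; rewrite -e l.
  by apply: h2; rewrite ?yy0.
by rewrite ltnS leq_eqVlt (negPf zj); apply: h2.
Qed.

(** A visit raises [nvisited] by one, and the new path is one edge longer than an old one at most;
    so path lengths stay below [nvisited], and therefore below [n]. *)
Lemma search_inv_visit y0 j ml mr pr dn f :
  matching ml mr -> y0 < n -> j < n -> reached ml pr y0 -> lt y0 j -> pr j = 0 ->
  search_inv y0 j ml mr pr dn f ->
  search_inv y0 j.+1 ml mr (upd pr j y0.+1) dn (if mr j == 0 then j.+1 else f).
Proof.
move=> [mlP mrP] y0n jn r0 lt0 prj [h1 h2 h3].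
have nv : nvisited (upd pr j y0.+1) = (nvisited pr).+1.
  have := count_upd pr (fun v => 0 < v) y0.+1 jn.
  by rewrite prj /= addn0 addn1.
have mono z : 0 < pr z -> 0 < upd pr j y0.+1 z by move=> /=; case: ifP.
split.
- move=> z zn; rewrite nv; case: (eqVneq z j) => [-> _|zj].
    have e : upd pr j y0.+1 j = y0.+1 by rewrite /= eqxx.
    case my : (ml y0) r0 => [|z']; rewrite /reached my /=.
      by exists 0; [rewrite ltnS|exists y0].
    have [z'n _ _] := mlP _ _ y0n my => /(h1 _ z'n)[k kn a].
    exists k.+1; first by rewrite ltnS.
    by exists y0; split=> //; exists z' => //; apply: alternating_visit.
  rewrite /= (negPf zj) => /(h1 _ zn)[k kn a]; exists k; first exact: ltnW.
  exact: alternating_visit.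
- move=> y z yn zn dy; case: (eqVneq z j) => [->|zj]; first by rewrite /= eqxx.
  rewrite ltnS leq_eqVlt (negPf zj) => h l; apply: mono; exact: h2 h l.
- case: eqP => [mj|/eqP mj]; first by split; rewrite //= eqxx.
  case: f h3 => [|f] /=.
    by move=> h3 z zn; case: eqP => [-> _|_]; [lia|exact: h3].
  by case=> fn pf mf; split=> //; case: eqP.
Qed.

(** The state in the middle of an augmentation: [z0] waits for a new partner, so no left vertex
    claims it, while its entry in [mr] may be stale. *)
Definition half_matching ml mr z0 : Prop :=
  (forall y z, y < n -> ml y = z.+1 ->
     [/\ z != z0, z < n, lt y z & mr z = y.+1]) /\
  (forall y z, z < n -> z != z0 -> mr z = y.+1 -> y < n /\ ml y = z.+1).

(** The number [c] of free left vertices drops only when the free end is reached. Since the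
    remaining length [k] satisfies [k + i < n], only the finished case is possible at [i = n]. *)
Definition augment_inv c pr ml mr f i : Prop :=
  if f is z.+1 then
    [/\ exists2 k, k + i < n & alternating pr ml k z, half_matching ml mr z
      & nfree ml = c]
  else matching ml mr /\ (nfree ml).+1 = c.

Lemma augment_inv_start pr ml mr z k :
  matching ml mr -> mr z = 0 -> k < n -> alternating pr ml k z ->
  augment_inv (nfree ml) pr ml mr z.+1 0.
Proof.
move=> [mlP mrP] mz kn a; split=> //; first by exists k; rewrite ?addn0.
split=> [y z' yn /(mlP _ _ yn)[z'n l m]|y z' z'n _]; last exact: mrP.
by split=> //; apply: contra_eq_neq m => ->; rewrite mz.
Qed.

Lemma augment_inv_step c pr ml mr z y i :
  pr z = y.+1 -> augment_inv c pr ml mr z.+1 i ->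
  augment_inv c pr (upd ml y z.+1) (upd mr z y.+1) (ml y) i.+1.
Proof.
move=> pz [[k ki a] [mlP mrP] free].
have [zn yn yz] : [/\ z < n, y < n & lt y z].
  by case: (k) a => [|k'] [y' [? ? + ? _]]; rewrite pz => -[->].
have cnt := count_upd ml (fun v => v == 0) z.+1 yn.
case my : (ml y) => [|z'].
  split; last by move: cnt; rewrite my eqxx /= addn0 addn1 -free.
  split=> y1 z1 /=.
    case: eqP => [-> _ [<-]|yy1 y1n /(mlP _ _ y1n)[z1z z1n l m]].
      by rewrite eqxx.
    by rewrite (negPf z1z).
  case: eqP => [-> _ [<-]|/eqP zz1 z1n]; first by rewrite eqxx.
  move=> /(mrP _ _ z1n zz1)[y1n m]; split=> //.
  by case: eqP => // e; rewrite e my in m.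
have [z'z z'n yz' mz'] := mlP _ _ yn my.
split.
- case: k a ki => [|k] a ki.
    by case: a => y' [_ _ + _]; rewrite pz => -[<-]; rewrite my.
  exists k; first by rewrite addnS -addSn.
  apply: (alternating_flip z.+1 a pz _ (ltnSn k)).
  by case: a => y' [_ _ + _]; rewrite pz => -[<-] [z1]; rewrite my => -[<-].
- split=> y1 z1 /=.
    case: eqP => [-> _ [<-]|/eqP yy1 y1n m].
      by rewrite eq_sym z'z eqxx.
    have [z1z z1n l m1] := mlP _ _ y1n m; split=> //; last by rewrite (negPf z1z).
    by apply: contra_neq yy1 => e; move: m1; rewrite e mz' => -[].
  move=> z1n z1z'; case: eqP => [-> [<-]|/eqP zz1]; first by rewrite eqxx.
  move=> /(mrP _ _ z1n zz1)[y1n m]; split=> //.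
  by case: eqP => // e; move: m z1z'; rewrite e my => -[->]; rewrite eqxx.
- by move: cnt; rewrite my /= !addn0 -free.
Qed.

End Matching.

(** * The program *)

Local Notation rmax := 0 (only parsing).
Local Notation rmin := 1 (only parsing).
Local Notation rx := 2 (only parsing).
Local Notation rround := 3 (only parsing).
Local Notation rstep := 4 (only parsing).
Local Notation ry := 5 (only parsing).
Local Notation rz := 6 (only parsing).
Local Notation rfound := 7 (only parsing).
Local Notation rcur := 8 (only parsing).
Local Notation rcount := 9 (only parsing).

Local Notation adist := 0 (only parsing).
Local Notation aleft := 1 (only parsing).
Local Notation aright := 2 (only parsing).
Local Notation apred := 3 (only parsing).
Local Notation adone := 4 (only parsing).

Local Notation vec a e := (HArr a (HLit 0) e).
Local Notation store_vec a e v := (HStore a (HLit 0) e v).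
Local Notation when e c := (HIf e c HSkip).

Local Notation "e1 [+] e2" := (HBin Add e1 e2) (at level 50, left associativity).
Local Notation "e1 [-] e2" := (HBin Sub e1 e2) (at level 50, left associativity).
Local Notation "e1 [=] e2" := (HBin Eq e1 e2) (at level 70, no associativity).
Local Notation "e1 [<] e2" := (HBin Lt e1 e2) (at level 70, no associativity).
Local Notation "c1 ;; c2" := (HSeq c1 c2) (at level 99, right associativity).
Local Notation "r <-- e" := (HSet r e) (at level 90, no associativity).
Local Notation "# r" := (HVar r) (at level 8, format "# r").

(** The value [n] plays the part of infinity, as all distances in a connected graph are smaller. *)
Definition init_row : hcmd :=
  HFor ry
    (HIf (#rx [=] #ry) (HStore adist #rx #ry (HLit 0)) (HStore adist #rx #ry HN)).

Definition init_dist : hcmd := HFor rx init_row.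

Definition relax : hcmd :=
  when (HInp #ry #rz)
    (when (HArr adist #rx #ry [+] HLit 1 [<] HArr adist #rx #rz)
      (HStore adist #rx #rz (HArr adist #rx #ry [+] HLit 1))).

(** The Bellman-Ford method, run from all sources at once. *)
Definition all_distances : hcmd :=
  init_dist ;; HFor rround (HFor rx (HFor ry (HFor rz relax))).

Definition clear_matching : hcmd :=
  HFor ry (store_vec aleft #ry (HLit 0) ;; store_vec aright #ry (HLit 0)).

Definition clear_search : hcmd :=
  rfound <-- HLit 0 ;;
  HFor ry (store_vec apred #ry (HLit 0) ;; store_vec adone #ry (HLit 0)).

Definition select_body : hcmd :=
  when (vec adone #ry [=] HLit 0)
    (HIf (vec aleft #ry [=] HLit 0) (rcur <-- #ry [+] HLit 1)
      (when (vec apred (vec aleft #ry [-] HLit 1)) (rcur <-- #ry [+] HLit 1))).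

Definition select_left : hcmd := rcur <-- HLit 0 ;; HFor ry select_body.

Definition scan_body : hcmd :=
  HIf (#ry [=] #rz) HSkip
    (when (HArr adist #rx #ry [+] HArr adist #ry #rz [=] HArr adist #rx #rz)
      (when (vec apred #rz [=] HLit 0)
        (store_vec apred #rz #rcur ;;
         when (vec aright #rz [=] HLit 0) (rfound <-- #rz [+] HLit 1)))).

Definition expand : hcmd :=
  select_left ;;
  when #rcur
    (ry <-- #rcur [-] HLit 1 ;; store_vec adone #ry (HLit 1) ;;
     HFor rz scan_body).

(** The old partner of [ry] is saved before it is overwritten and becomes the next vertex to serve.
    A free [ry] yields 0, after which the remaining rounds are idle. *)
Definition augment_body : hcmd :=
  when #rfound
    (rz <-- #rfound [-] HLit 1 ;;
     ry <-- vec apred #rz [-] HLit 1 ;;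
     rcur <-- vec aleft #ry ;;
     store_vec aleft #ry #rfound ;;
     store_vec aright #rz (vec apred #rz) ;;
     rfound <-- #rcur).

Definition round : hcmd :=
  clear_search ;; HFor rstep expand ;; HFor rstep augment_body.

Definition count_free : hcmd :=
  rcount <-- HLit 0 ;;
  HFor ry (when (vec aleft #ry [=] HLit 0) (rcount <-- #rcount [+] HLit 1)).

Definition position_number : hcmd :=
  clear_matching ;; HFor rround round ;; count_free.

Definition collect : hcmd :=
  position_number ;;
  when (#rmax [<] #rcount) (rmax <-- #rcount) ;;
  when (#rcount [<] #rmin) (rmin <-- #rcount).

Definition vertex_position : hcmd :=
  all_distances ;; rmin <-- HN ;; HFor rx collect.

Lemma vertex_position_slow : slow_cmd vertex_position.
Proof. by []. Qed.

(** Attained twice: by rounds and triples in the relaxation, and by roots, augmentations, expansions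
    and scans in the matching. *)
Lemma vertex_position_depth : hdepth vertex_position = 4.
Proof. by []. Qed.

Section Programs.
Variables (n : nat) (inp : nat -> nat).
Local Notation run := (run n inp).

(** * Correctness of the matching algorithm *)

Section FixedRoot.
Variables (D : nat -> nat -> nat) (x : nat).

Definition prec (y z : nat) : bool := (y != z) && (D x y + D y z == D x z).

Definition context (s : hstate) : Prop := ha s adist = D /\ hv s rx = x.

Local Notation left s := (ha s aleft 0).
Local Notation right s := (ha s aright 0).
Local Notation pred s := (ha s apred 0).
Local Notation done s := (ha s adone 0).

Lemma context_run c s : adist \notin stored c -> rx \notin assigned c ->
  context s -> context (run c s).
Proof. by move=> ha hv [h1 h2]; split; rewrite ?run_ha ?run_hv. Qed.

Lemma clear_matchingP s : let s' := run clear_matching s in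
  (forall y, y < n -> left s' y = 0) /\ (forall y, y < n -> right s' y = 0).
Proof.
apply: (run_for (P := fun i s => (forall y, y < i -> left s y = 0) /\
  (forall y, y < i -> right s y = 0))) => //= i s1 _ [h1 h2].
by split=> y; rewrite ltnS leq_eqVlt; case: eqP => //= _; [apply: h1|apply: h2].
Qed.

Lemma clear_searchP s : let s' := run clear_search s in
  [/\ forall y, y < n -> pred s' y = 0, forall y, y < n -> done s' y = 0
    & hv s' rfound = 0].
Proof.
rewrite /clear_search run_seq.
split; last by rewrite run_hv.
- apply: (run_for (P := fun i s => (forall y, y < i -> pred s y = 0))) => //=.
  move=> i s1 _ h y; rewrite ltnS leq_eqVlt; case: eqP => //= _; exact: h.
- apply: (run_for (P := fun i s => (forall y, y < i -> done s y = 0))) => //=.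
  move=> i s1 _ h y; rewrite ltnS leq_eqVlt; case: eqP => //= _; exact: h.
Qed.

Definition select_spec i s : Prop :=
  if hv s rcur is y.+1
  then [/\ y < n, reached (left s) (pred s) y & done s y = 0]
  else forall y, y < i -> reached (left s) (pred s) y -> 0 < done s y.

Lemma select_leftP s : select_spec n (run select_left s).
Proof.
rewrite /select_left run_seq; apply: run_for => //= i s1 lin h.
rewrite /select_body !run_if /= eqb0 negbK; case: eqP => [d0|/eqP d1]; last first.
  move: h; rewrite /select_spec /=; case: (hv s1 rcur) => // h y.
  by rewrite ltnS leq_eqVlt; case: eqP => [-> _ _|_] /=; [lia|apply: h].
have new : reached (left s1) (pred s1) i ->
    select_spec i.+1 (hset (hset s1 ry i) rcur (i + 1)).
  by move=> r; rewrite /select_spec /= addn1.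
rewrite eqb0 negbK; case: eqP => [l0|/eqP l0].
  by apply: new; rewrite /reached l0.
rewrite subn1; case: eqP => [p0|/eqP p0] /=; last first.
  by apply: new; rewrite /reached lt0n p0 orbT.
move: h; rewrite /select_spec /=; case: (hv s1 rcur) => // h y.
rewrite ltnS leq_eqVlt; case: eqP => [-> _|_] /=; last exact: h.
by rewrite /reached p0 (negPf l0).
Qed.

Lemma scanP s y0 :
  context s -> matching n prec (left s) (right s) ->
  y0 < n -> hv s ry = y0 -> hv s rcur = y0.+1 ->
  reached (left s) (pred s) y0 ->
  search_inv n prec y0 0 (left s) (right s) (pred s) (done s) (hv s rfound) ->
  let s' := run (HFor rz scan_body) s in
  search_inv n prec y0 n (left s) (right s) (pred s') (done s) (hv s' rfound).
Proof.
move=> ctx mat y0n hy hc r0 inv.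
set l := left s in mat r0 inv *; set r := right s in mat inv *.
set dn := done s in inv *.
pose P i s := [/\ context s, left s = l /\ right s = r,
  hv s ry = y0 /\ hv s rcur = y0.+1, reached l (pred s) y0
  & search_inv n prec y0 i l r (pred s) dn (hv s rfound)].
suff [] : P n (run (HFor rz scan_body) s) by [].
apply: run_for => // i s1 lin [[hD hx] [hl hr] [h5 h8] r1 inv1].
have skip : ~~ prec y0 i || (0 < pred s1 i) -> P i.+1 (hset s1 rz i).
  by move=> sk; split=> //=; apply: search_inv_skip.
rewrite /scan_body !run_if /= eqb0 negbK h5 hx; case: eqP => [e|/eqP ne].
  by apply: skip; rewrite /prec e eqxx.
rewrite eqb0 negbK hD; case: eqP => [e|/eqP ne2]; last first.
  by apply: skip; rewrite /prec (negPf ne2) andbF.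
rewrite eqb0 negbK; case: eqP => [p0|/eqP p0]; last first.
  by apply: skip; rewrite lt0n p0 orbT.
have lt0 : prec y0 i by rewrite /prec ne e eqxx.
have := search_inv_visit mat y0n lin r1 lt0 p0 inv1.
have r2 : reached l (upd (pred s1) i y0.+1) y0.
  by move: r1; rewrite /reached /=; case: eqP => //= _; case: eqP.
rewrite run_if /= hr eqb0 negbK; case: eqP => _ inv2;
  split=> //=; rewrite ?h8 ?addn1 //.
Qed.

(** Either every reached vertex is processed or each round has processed a new one, so [n] rounds
    complete the search. The index [c] is immaterial, as the comparisons have run up to [n]. *)
Definition expand_inv c l r i s : Prop :=
  [/\ context s, left s = l /\ right s = r,
    search_inv n prec c n l r (pred s) (done s) (hv s rfound) &
    (forall y, y < n -> reached l (pred s) y -> 0 < done s y) \/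
    i <= count (fun y => 0 < done s y) (iota 0 n)].

Lemma expandP l r i s : matching n prec l r ->
  expand_inv 0 l r i s -> expand_inv 0 l r i.+1 (run expand s).
Proof.
move=> mat [ctx [hl hr] inv cnt].
rewrite /expand run_seq; move e1 : (run select_left s) => s1.
have ctx1 : context s1 by rewrite -e1; apply: context_run.
have [hl1 hr1 hp1 hd1] : [/\ left s1 = l, right s1 = r, pred s1 = pred s
    & done s1 = done s].
  by split; rewrite -e1 run_ha.
have hf1 : hv s1 rfound = hv s rfound by rewrite -e1 run_hv.
have := select_leftP s; rewrite e1 /select_spec hl1 hp1 hd1.
rewrite run_if [hev _ _ _ _]/=; case hc : (hv s1 rcur) => [|y].
  rewrite /= => all; split=> //; first by rewrite hp1 hd1 hf1.
  by left; rewrite hp1 hd1.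
case=> yn reach dy; rewrite [_ != _]/= 2!run_seq.
set s2 := run (store_vec _ _ _) _.
have e2 : done s2 = upd (done s) y 1 by rewrite /s2 /= subn1 hc -hd1.
have inv2 :
    search_inv n prec y 0 (left s2) (right s2) (pred s2) (done s2) (hv s2 rfound).
  rewrite e2 /s2 /= hl1 hr1 hp1 hf1; exact: search_inv_process inv.
have ctx2 : context s2 by [].
have hy2 : hv s2 ry = y by rewrite /s2 /= hc subn1.
have := @scanP s2 y ctx2; rewrite [left s2]hl1 [right s2]hr1 [pred s2]hp1.
rewrite {1}/s2 /= hl1 hr1 hp1 in inv2.
move=> /(_ mat yn hy2 hc reach inv2); set s3 := run _ s2 => inv3.
have hd3 : done s3 = upd (done s) y 1 by rewrite run_ha.
split.
- exact: context_run.
- by rewrite !run_ha.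
- by rewrite hd3 -e2; apply: search_inv_done inv3.
- right; rewrite hd3.
  case: cnt => [all|le]; first by have := all y yn reach; rewrite dy.
  have := count_upd (done s) (fun v => 0 < v) 1 yn.
  by rewrite dy /= addn0 addn1 => ->.
Qed.

Lemma searchP s : context s -> matching n prec (left s) (right s) ->
  let s' := run (HFor rstep expand) (run clear_search s) in
  search_inv n prec 0 n (left s) (right s) (pred s') (done s') (hv s' rfound) /\
  forall y, y < n -> reached (left s) (pred s') y -> 0 < done s' y.
Proof.
move=> ctx mat; have [p0 d0 f0] := clear_searchP s.
set s1 := run clear_search s in p0 d0 f0 *; move=> s'.
suff [_ _ inv cnt] : expand_inv 0 (left s) (right s) n s'.
  split=> //; case: cnt => // le y yn _.
  have : all (fun y => 0 < done s' y) (iota 0 n).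
    by rewrite all_count size_iota eqn_leq le -{2}(size_iota 0 n) count_size.
  by move/allP; apply; rewrite mem_iota.
apply: (run_for (P := expand_inv 0 (left s) (right s))) => //.
  split; [exact: context_run|by rewrite !run_ha| |by right].
  by rewrite f0; apply: search_inv0.
by move=> i s2 _ h; apply: expandP.
Qed.

Lemma augmentP s z k :
  matching n prec (left s) (right s) -> hv s rfound = z.+1 -> right s z = 0 ->
  k < n -> alternating n prec (pred s) (left s) k z ->
  let s' := run (HFor rstep augment_body) s in
  matching n prec (left s') (right s') /\ (nfree n (left s')).+1 = nfree n (left s).
Proof.
move=> mat fz rz0 kn a s'.
pose P i s1 := pred s1 = pred s /\
  augment_inv n prec (nfree n (left s)) (pred s) (left s1) (right s1)
    (hv s1 rfound) i.
suff [_] : P n s'.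
  by case: (hv s' _) => // f [[k' + _]]; rewrite ltnNge leq_addl.
apply: run_for => //; first by split=> //; rewrite fz; apply: augment_inv_start a.
move=> i s1 lin [pE]; rewrite /augment_body run_if [hev _ _ _ _]/=.
case f1 : (hv s1 rfound) => [|f] inv; first by split; rewrite //= f1.
have [y py] : exists y, pred s f = y.+1.
  by case: inv => [[[|k'] _ [y []]]]; exists y.
rewrite /= f1 subn1 /= pE py subn1 /=.
split=> //; exact: augment_inv_step inv.
Qed.

(** Recording that a successful augmentation started from a matching that was not stuck makes being
    stuck permanent, which the invariant over the rounds requires. *)
Lemma roundP s : context s -> matching n prec (left s) (right s) ->
  let s' := run round s in
  matching n prec (left s') (right s') /\
  (stuck n prec (left s') (right s') \/
   ~ stuck n prec (left s) (right s) /\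
   (nfree n (left s')).+1 = nfree n (left s)).
Proof.
move=> ctx mat; have := searchP ctx mat; cbv zeta.
rewrite /round 2!run_seq; move e1 : (run (HFor _ _) (run _ _)) => s1.
have [hl hr] : left s1 = left s /\ right s1 = right s by rewrite -e1 !run_ha.
case f1 : (hv s1 rfound) => [|z] [inv all]; set s' := run _ s1.
  have noop : [/\ left s' = left s, right s' = right s & hv s' rfound = 0].
    apply: (run_for (P := fun _ s2 => [/\ left s2 = left s, right s2 = right s
      & hv s2 rfound = 0])) => // i s2 _ [h1 h2 h3].
    by rewrite /augment_body run_if /= h3.
  have [-> -> _] := noop; split=> //; left; exists (pred s1).
  have [h1 h2 h3] := inv; split=> // y z yn zn r.
  by apply: h2 => //; [exact: all|rewrite zn orbT].
have [h1 h2 [zn pz mz]] := inv; have [k kn a] := h1 z zn pz.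
have kn' : k < n.
  by apply: leq_trans kn _; rewrite -{2}(size_iota 0 n) count_size.
have [] := @augmentP s1 z k; rewrite ?hl ?hr // => mat' free'.
by split=> //; right; split=> // /stuck_alternating-/(_ _ _ _ a); rewrite mz.
Qed.

Lemma position_numberP s : context s -> let s' := run position_number s in
  exists l r, [/\ matching n prec l r, stuck n prec l r \/ nfree n l = 0
    & hv s' rcount = nfree n l].
Proof.
move=> ctx; rewrite /position_number 2!run_seq.
set s1 := run (HFor _ _) _; set s' := run _ s1.
have [_ mat1 st1] : [/\ context s1, matching n prec (left s1) (right s1)
    & stuck n prec (left s1) (right s1) \/ nfree n (left s1) + n <= n].
  apply: (run_for (P := fun i s => [/\ context s,
    matching n prec (left s) (right s)
    & stuck n prec (left s) (right s) \/ nfree n (left s) + i <= n])) => //.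
    have [l0 r0] := clear_matchingP s; split; first exact: context_run.
      by split=> y z h; [rewrite l0|rewrite r0].
    by right; rewrite addn0 (leq_trans (count_size _ _)) ?size_iota.
  move=> i s2 _ [ctx2 mat2 h]; have ctx3 : context (hset s2 rround i) by [].
  have [mat3 h3] := roundP ctx3 mat2; split=> //; first exact: context_run.
  by case: h3 => [|[h4 h5]]; [left|right; case: h => //; rewrite addnS -addSn h5].
exists (left s1), (right s1); split=> //; first by case: st1; [left|right; lia].
have : left s' = left s1 /\
    hv s' rcount = count (fun y => left s1 y == 0) (iota 0 n).
  rewrite /s' /count_free run_seq.
  apply: (run_for (P := fun i s => left s = left s1 /\
    hv s rcount = count (fun y => left s1 y == 0) (iota 0 i))) => // i s2 _ [hl hc].
  rewrite -[i.+1]addn1 iotaD count_cat run_if /= hl eqb0 negbK add0n addn0.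
  by case: eqP => _ /=; rewrite hc ?addn0.
by case.
Qed.

End FixedRoot.
End Programs.

(** * Correctness on graphs *)

(** A loop rule for facts [Q i] that survive any decrease of the distance table: what one round
    establishes is kept by the later ones. *)
Lemma run_for_all n inp r c s (I : hstate -> Prop)
    (Q : nat -> (nat -> nat -> nat) -> Prop) :
  let shrink (D D' : nat -> nat -> nat) := forall a b, D' a b <= D a b in
  (forall i D D', shrink D D' -> Q i D -> Q i D') ->
  (forall s v, I s -> I (hset s r v)) ->
  (forall i s, i < n -> I s -> hv s r = i ->
     let s' := run n inp c s in
     [/\ I s', shrink (ha s adist) (ha s' adist) & Q i (ha s' adist)]) ->
  I s ->
  let s' := run n inp (HFor r c) s in
  [/\ I s', shrink (ha s adist) (ha s' adist) & forall i, i < n -> Q i (ha s' adist)].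
Proof.
move=> shrink Qs Is step I0.
apply: (run_for (P := fun i s' => [/\ I s', shrink (ha s adist) (ha s' adist)
  & forall j, j < i -> Q j (ha s' adist)])) => //.
- by split=> // a b.
- move=> i s1 lin [I1 sh1 Q1].
  have [||I2 sh2 Q2] := step i (hset s1 r i) lin; first exact: Is.
    by rewrite /= eqxx.
  split=> // [a b|j]; first exact: leq_trans (sh2 a b) (sh1 a b).
  rewrite ltnS leq_eqVlt => /orP[/eqP->//|/Q1]; exact: Qs sh2.
- by move=> s1 [I1 sh1 Q1]; split=> //; apply: Is.
Qed.

Section Graph.
Variable G : sgraph.
Local Notation n := #|G|.
Local Notation inp := (adj_matrix G).
Local Notation run := (run n inp).

Definition rank (v : G) : nat := enum_rank v.

Lemma rank_lt v : rank v < n.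
Proof. exact: ltn_ord. Qed.

Lemma rank_inj : injective rank.
Proof. by move=> u v /ord_inj/enum_rank_inj. Qed.

Lemma rank_surj i : i < n -> exists v, rank v = i.
Proof. by move=> lin; exists (enum_val (Ordinal lin)); rewrite /rank enum_valK. Qed.

Lemma adj_matrixE u v : adj_matrix G (rank u * n + rank v) = adj u v.
Proof.
congr nat_of_bool; apply/existsP/idP => [[u' /existsP[v' /andP[/eqP e a]]]|a].
  have n0 : 0 < n by apply: leq_ltn_trans (rank_lt u).
  have := congr1 (divn^~ n) e; have := congr1 (modn^~ n) e.
  rewrite !modnMDl !modn_small ?ltn_ord ?rank_lt //.
  rewrite !divnMDl // !divn_small ?ltn_ord ?rank_lt // !addn0.
  by move=> /rank_inj-> /rank_inj->.
by exists u; apply/existsP; exists v; rewrite eqxx.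
Qed.

Lemma adj_matrix_out p : n * n <= p -> adj_matrix G p = 0.
Proof.
move=> le; apply/eqP; rewrite eqb0; apply/negP.
move=> /existsP[u /existsP[v /andP[/eqP e _]]].
have ub := rank_lt u; have vb := rank_lt v; rewrite /rank in ub vb.
by have := leq_mul ub (leqnn n); rewrite mulSn; lia.
Qed.

Lemma card_count (p : pred nat) :
  count p (iota 0 n) = #|[set v : G | p (rank v)]|.
Proof.
rewrite -(card_imset _ enum_rank_inj) -val_enum_ord count_map.
have -> : [set enum_rank v | v in [set v : G | p (rank v)]] = [set i : 'I_n | p i].
  apply/setP=> i; rewrite inE; apply/imsetP/idP => [[v]|pi].
    by rewrite inE => pv ->.
  by exists (enum_val i); rewrite ?inE /rank enum_valK.
by rewrite cardsE cardE -size_filter enumT.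
Qed.

Lemma pnum_matching (D : nat -> nat -> nat) (x : G) l r :
  distance_spec (fun u v => D (rank u) (rank v)) ->
  matching n (prec D (rank x)) l r ->
  stuck n (prec D (rank x)) l r \/ nfree n l = 0 ->
  pnum x = nfree n l.
Proof.
set d := fun u v => _; move=> dP [lP rP] st.
have precE y z : prec D (rank x) (rank y) (rank z) = before d x y z.
  by rewrite /prec /before (inj_eq rank_inj).
pose m (y : G) : option G :=
  if l (rank y) is z.+1 then [pick v | rank v == z] else None.
have mS y z : m y = Some z <-> l (rank y) = (rank z).+1.
  rewrite /m; case e: (l (rank y)) => [|i]; first by split.
  case: pickP => [v /eqP vi|no].
    by split=> [[<-]|[iz]]; rewrite ?vi //; congr Some; apply: rank_inj; rewrite vi.
  by split=> // -[iz]; have := no z; rewrite iz eqxx.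
have freeE : nfree n l = #|[set y | m y == None]|.
  rewrite /nfree card_count; congr #|pred_of_set _|; apply/setP=> y; rewrite !inE /m.
  case e: (l (rank y)) => [|i] //=; have [lin _ _] := lP _ _ (rank_lt y) e.
  by have [v vi] := rank_surj lin; case: pickP => // /(_ v); rewrite vi eqxx.
have m_lt y z : m y = Some z -> before d x y z.
  by move=> /mS/(lP _ _ (rank_lt y))[_]; rewrite precE.
have m_inj y1 y2 z : m y1 = Some z -> m y2 = Some z -> y1 = y2.
  move=> /mS/(lP _ _ (rank_lt y1))[_ _ e1] /mS/(lP _ _ (rank_lt y2))[_ _ e2].
  by apply: rank_inj; move: e2; rewrite e1 => -[].
have ub S : antichain (before d x) S -> #|S| <= nfree n l.
  by rewrite freeE; apply: (antichain_card_le (@before_trans _ _ dP x) m_lt m_inj).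
(* Without free vertices the upper bound is 0, and the empty antichain attains it. *)
case: st => [[vis [closed matched]]|n0]; last first.
  apply: (pnum_unique dP (A := set0) ub); last by rewrite n0.
  by move=> y z; rewrite inE.
have [||A aA le] := @antichain_of_certificate _ (before d x) m
    [set z | 0 < vis (rank z)].
- move=> y z; rewrite !inE => yr yz.
  apply: (closed (rank y) (rank z)); rewrite ?rank_lt ?precE //; move: yr.
  rewrite /reached /m; case e: (l (rank y)) => [|i] //=.
  by case: pickP => [v /= /eqP<-|/= no]; rewrite ?inE // => _;
    have [lin _ _] := lP _ _ (rank_lt y) e; have [v vi] := rank_surj lin;
    have := no v; rewrite vi eqxx.
- move=> z; rewrite inE => /(matched _ (rank_lt z)).
  case e: (r (rank z)) => [|i] // _; have [lin li] := rP _ _ (rank_lt z) e.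
  by have [y yi] := rank_surj lin; exists y; apply/mS; rewrite yi.
by apply: (pnum_unique dP ub aA); rewrite freeE.
Qed.

(** * Distances *)

(** Entries that are at least [n] stand for infinity and promise no walk. *)
Definition sound (D : nat -> nat -> nat) : Prop :=
  forall u v : G, D (rank u) (rank v) < n ->
  exists p, [/\ path (@adj G) u p, last u p = v & size p = D (rank u) (rank v)].

Definition complete_upto i (D : nat -> nat -> nat) : Prop :=
  forall (u : G) p, path (@adj G) u p -> size p <= i ->
  D (rank u) (rank (last u p)) <= size p.

Lemma init_distP s : let D := ha (run init_dist s) adist in
  sound D /\ complete_upto 0 D.
Proof.
suff h a b : a < n -> b < n ->
    ha (run init_dist s) adist a b = if a == b then 0 else n.
  cbv zeta; split=> [u v|u [|//] _ _]; last by rewrite h ?rank_lt ?eqxx.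
  rewrite h ?rank_lt //; case: eqP => [/rank_inj-> _|]; first by exists [::].
  by rewrite ltnn.
pose row i s := forall b, b < n -> ha s adist i b = if i == b then 0 else n.
move: a b; suff : forall a, a < n -> row a (run init_dist s).
  by move=> h a b /h; apply.
apply: (run_for (P := fun i s => forall a, a < i -> row a s)) => // i s1 lin h.
pose Q j s := [/\ hv s rx = i, forall a, a < i -> row a s
  & forall b, b < j -> ha s adist i b = if i == b then 0 else n].
suff [_ h1 h2] : Q n (run init_row (hset s1 rx i)).
  by move=> a; rewrite ltnS leq_eqVlt => /orP[/eqP->|/h1].
apply: run_for => // j s2 ljn [h2 hr hd]; rewrite run_if /= eqb0 negbK h2.
have gen v : v = (if i == j then 0 else n) -> Q j.+1 (hstore (hset s2 ry j) 0 i j v).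
  move=> vE; split=> //= [a ai b bn|b].
    by rewrite /= (ltn_eqF ai); apply: hr.
  rewrite eqxx /= ltnS leq_eqVlt; case: eqP => [-> _|_] //=; exact: hd.
by case: ifP => e; apply: gen; rewrite e.
Qed.

Lemma relaxP u v w s :
  hv s rx = rank u -> hv s ry = rank v -> hv s rz = rank w -> sound (ha s adist) ->
  let D := ha s adist in let D' := ha (run relax s) adist in
  [/\ sound D', forall a b, D' a b <= D a b &
    adj v w -> D' (rank u) (rank w) <= (D (rank u) (rank v)).+1].
Proof.
move=> hu hv' hw sD D D'; rewrite /D' /relax !run_if /= hu hv' hw adj_matrixE -/D.
rewrite eqb0 negbK; case: ifP => [avw|_]; last by split.
rewrite eqb0 negbK addn1; case: ltnP => [lt|ge] /=; last by split.
split=> [u1 v1|a b|_].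
- case: (eqVneq (rank u1) _) => [/rank_inj->|_] /=; last exact: sD.
  case: (eqVneq (rank v1) _) => [/rank_inj->|_]; last exact: sD.
  move=> ltn; have [p [pp lp sp]] := sD u v (ltnW ltn).
  by exists (rcons p w); rewrite rcons_path last_rcons size_rcons pp lp sp.
- case: (eqVneq a _) => [->|_] //=; case: (eqVneq b _) => [->|_] //.
  exact: ltnW lt.
- by rewrite !eqxx /= eqxx.
Qed.

(** The table is updated in place, so a relaxation may read newer entries than those of [D]; these
    are only smaller, and the bound in terms of [D] persists. *)
Lemma relax_allP s : sound (ha s adist) ->
  let D := ha s adist in
  let D' := ha (run (HFor rx (HFor ry (HFor rz relax))) s) adist in
  [/\ sound D', forall a b, D' a b <= D a b &
    forall u v w, adj v w -> D' (rank u) (rank w) <= (D (rank u) (rank v)).+1].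
Proof.
move=> s0 D; set s' := run _ _.
pose I1 s := sound (ha s adist) /\ forall a b, ha s adist a b <= D a b.
pose edge a b c (E : nat -> nat -> nat) :=
  forall u v w : G, rank u = a -> rank v = b -> rank w = c -> adj v w ->
  E a c <= (D a b).+1.
have edge_shrink a b c E E' : (forall a b, E' a b <= E a b) ->
    edge a b c E -> edge a b c E'.
  by move=> sh h u v w ua vb wc /(h u v w ua vb wc); apply: leq_trans.
have [||||I' sh h] := @run_for_all n inp rx (HFor ry (HFor rz relax)) s I1
  (fun a E => forall b, b < n -> forall c, c < n -> edge a b c E).
- by move=> a E E' sh h b bn c cn; apply: edge_shrink (h b bn c cn).
- by [].
- move=> a s1 an I1s h2.
  have [||||[I2 _] sh2 E2] := @run_for_all n inp ry (HFor rz relax) s1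
    (fun s => I1 s /\ hv s rx = a) (fun b E => forall c, c < n -> edge a b c E).
  + by move=> b E E' sh h c cn; apply: edge_shrink (h c cn).
  + by [].
  + move=> b s2 bn [I2s h22] h5.
    have [||||[I3 h3] sh3 E3] := @run_for_all n inp rz relax s2
      (fun s => [/\ I1 s, hv s rx = a & hv s ry = b]) (edge a b).
    * by move=> c; apply: edge_shrink.
    * by move=> s3 v [].
    * move=> c s3 cn [[sd shD] h32 h35] h36.
      have [u ua] := rank_surj an; have [v vb] := rank_surj bn.
      have [w wc] := rank_surj cn.
      have [||||sd' sh' e'] := @relaxP u v w s3; rewrite ?ua ?vb ?wc //.
      split=> //.
        split; [|by rewrite run_hv..]; split=> // a' b'.
        exact: leq_trans (sh' a' b') (shD a' b').
      move=> u1 v1 w1 ua1 vb1 wc1.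
      have -> : v1 = v by apply: rank_inj; rewrite vb1.
      have -> : w1 = w by apply: rank_inj; rewrite wc1.
      rewrite ua vb wc in e'.
      move=> /e' le; apply: leq_trans le _; rewrite ltnS; exact: shD.
    * by [].
    by split=> //; rewrite h3.
  + by [].
  by split.
- by [].
have [sd shD] := I'; split=> // u v w avw.
exact: (h _ (rank_lt u) _ (rank_lt v) _ (rank_lt w) u v w).
Qed.

Lemma all_distancesP s : connected_graph G ->
  distance_spec (fun u v : G => ha (run all_distances s) adist (rank u) (rank v)).
Proof.
move=> [_ conn]; rewrite /all_distances run_seq; set s1 := run init_dist s.
set s' := run _ s1.
have [sd cp] : sound (ha s' adist) /\ complete_upto n (ha s' adist).
  apply: (run_for (P := fun i s =>
    sound (ha s adist) /\ complete_upto i (ha s adist))).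
  - exact: init_distP.
  - move=> i s2 _ [sd cp].
    have [//|sd' sh e] := @relax_allP (hset s2 rround i); split=> // u p.
    case/lastP: p => [|p w].
      by move=> _ _; apply: leq_trans (sh _ _) (cp u [::] _ _).
    rewrite rcons_path last_rcons size_rcons ltnS => /andP[pp pw] pi.
    by apply: leq_trans (e u _ _ pw) _; rewrite ltnS; apply: cp.
  - by [].
(* Shortening leaves fewer than [n] edges: [n] rounds therefore cover all walks, and the resulting
   entries lie below [n], where [sound] applies. *)
have short (u : G) p : path (@adj G) u p -> exists q, [/\ path (@adj G) u q,
    last u q = last u p, size q < n & size q <= size p].
  move=> /shortened[q [pq lq uq sub]]; exists q; split=> //.
    by have := max_card [in u :: q]; rewrite (card_uniqP uq).
  by apply: uniq_leq_size sub; case/andP: uq.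
have bound (u : G) p : path (@adj G) u p ->
    ha s' adist (rank u) (rank (last u p)) <= size p.
  move=> /short[q [pq <- sq le]]; apply: leq_trans (cp u q pq (ltnW sq)) le.
split=> // u v; apply: sd; have /connectP[p pp ->] := conn u v.
have [q [pq <- sq _]] := short u p pp.
exact: leq_ltn_trans (bound u q pq) sq.
Qed.

Lemma vertex_positionP s : connected_graph G -> hv s rmax = 0 ->
  let s' := run vertex_position s in hv s' rmin = vpm G /\ hv s' rmax = vp G.
Proof.
move=> conn h0 s'; rewrite /s' /vertex_position 2!run_seq.
have dP := all_distancesP s conn; move: dP.
have h00 : hv (run all_distances s) rmax = 0 by rewrite run_hv.
move: (run all_distances s) h00 => s1 h00 dP; set D := ha s1 adist in dP.
set s2 := run _ _.
(* The running extremes are described by their upper and lower bounds, so that a round only adds one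
   condition, on the new root. *)
have [_ hmax hmin] : [/\ ha s2 adist = D,
    forall m, hv s2 rmax <= m <-> forall v, rank v < n -> pnum v <= m &
    forall m, m <= hv s2 rmin <-> m <= n /\ forall v, rank v < n -> m <= pnum v].
  apply: (run_for (P := fun i s => [/\ ha s adist = D,
    forall m, hv s rmax <= m <-> forall v, rank v < i -> pnum v <= m &
    forall m, m <= hv s rmin <-> m <= n /\ forall v, rank v < i -> m <= pnum v])) => //.
    split=> // m; rewrite /= ?h00; split=> //; by case.
  move=> i s3 lin [hD hmx hmn]; have [x xi] := rank_surj lin.
  rewrite /collect run_seq; set s4 := hset s3 rx i.
  have ctx : context D (rank x) s4 by split; rewrite //= xi.
  have [l [r [mat st hc]]] := @position_numberP n inp _ _ _ ctx.
  have pE := pnum_matching dP mat st.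
  have [hD5 h50 h51] : [/\ ha (run position_number s4) adist = D,
      hv (run position_number s4) rmax = hv s3 rmax
    & hv (run position_number s4) rmin = hv s3 rmin].
    by rewrite run_ha // !run_hv //; split.
  move: (run position_number s4) hc hD5 h50 h51 => s5; rewrite -pE => hc hD5 h50 h51.
  have split_lt (P : G -> Prop) : (forall v, rank v < i.+1 -> P v) <->
      (forall v, rank v < i -> P v) /\ P x.
    split=> [h|[h px] v]; first by split=> [v vi|]; apply: h; rewrite ?xi // ltnW.
    by rewrite ltnS leq_eqVlt => /orP[/eqP e|/h//];
      rewrite -(rank_inj (etrans xi (esym e))).
  set s6 := run _ s5.
  have [e0 e1 eD] : [/\ hv s6 rmax = maxn (hv s3 rmax) (pnum x),
      hv s6 rmin = minn (hv s3 rmin) (pnum x) & ha s6 adist = D].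
    rewrite /s6 run_seq !run_if /= hc h50.
    case: (ltnP (hv s3 rmax)) => lt0 /=; rewrite hc h51;
      case: (ltnP (pnum x)) => lt1 /=; rewrite ?hc ?h50 ?h51; split=> //; lia.
  split=> // m; rewrite ?e0 ?e1 split_lt.
    by rewrite geq_max -hmx; split=> [/andP[]|[-> ->]].
  rewrite leq_min; split=> [/andP[/hmn[mn h] mp]|[mn [h mp]]]; first by split.
  by rewrite mp andbT; apply/hmn.
split; apply/eqP; rewrite eqn_leq; apply/andP; split.
- rewrite leq_vpm; apply/andP; split; first by have [] := (hmin _).1 (leqnn _).
  by apply/forallP=> v; apply: ((hmin _).1 (leqnn _)).2; apply: rank_lt.
- have := leqnn (vpm G); rewrite leq_vpm => /andP[le /forallP all].
  by apply/hmin; split=> // v _; apply: all.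
- apply/hmax=> v _; have := leqnn (vp G); rewrite vp_leq => /forallP; exact.
- by rewrite vp_leq; apply/forallP=> v; apply: (hmax _).1 (leqnn _) _ (rank_lt v).
Qed.

End Graph.

(** * Word size and running time of the compiled program *)

Definition program : cmd := Seq (comp vertex_position) (SetReg 0 (Reg rmin.+1)).

Lemma program_correct : exists K k,
  computes_on_connected program k (fun n => K * n.+1 ^ 4) vpm vp.
Proof.
have [K timeK] := htime_poly vertex_position.
rewrite vertex_position_depth in timeK.
(* The final move takes 2 time units, whence [K + 2]. In [K + 6], a share of [K + 2] pays for that
   constant, as [K + 2 <= 2 ^ (K + 2)], and 4 for the fourth power of [n.+1 <= 2 ^ bitlen n]; the
   other factor is the exponent of the expressions. *)
exists (K + 2), ((K + 6) * (hsize vertex_position).+1) => G conn.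
set n := #|G|; set w := _ * bitlen n.
have n0 : 0 < n by case: conn.
have pow4 : n < n.+1 ^ 4 by rewrite (leq_trans _ (leq_pexp2l _ (_ : 1 <= 4))).
have big : (n + htime n vertex_position).+2 ^ (hsize vertex_position).+1 <= 2 ^ w.
  rewrite /w mulnAC expnM leq_exp2r //.
  have nb : n < 2 ^ bitlen n by rewrite trunc_log_ltn.
  have -> : (K + 6) * bitlen n = (K + 2) * bitlen n + bitlen n * 4 by lia.
  rewrite expnD (expnM _ _ 4).
  apply: leq_trans (_ : (K + 2) * n.+1 ^ 4 <= _).
    by have := timeK n; lia.
  apply: leq_mul; last by rewrite leq_exp2r.
  apply: leq_trans (ltnW (ltn_expl _ (ltnSn 1))) _.
  by rewrite leq_exp2l // leq_pmulr.
pose s0 := HState (fun=> 0) (fun _ _ _ => 0).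
have rep : represents n (adj_matrix G) (input G) s0.
  split=> //= a i j; apply: adj_matrix_out; exact: leq_addr.
have bnd : bounded n (input G).
  split=> [r|a] /=; first by case: ifP.
  exact: leq_trans (leq_b1 _) n0.
have [|t [rs [ex lt_t repf bf]]] := simulation (w := w) (@adj_matrix_out G)
    vertex_position_slow n0 rep bnd.
  by apply: leq_trans big; rewrite leq_exp2l.
have [hmin hmax] := vertex_positionP conn (erefl : hv s0 rmax = 0).
have [_ rr _ _] := repf.
(* By the shift of registers, [rmax] already sits in register 1, and the minimum is moved from
   register 2 over the order in register 0. *)
exists (t + 2), (set_reg rs 0 (regs rs 2)); split.
- apply: ExecSeq ex _; apply: (@ExecSetReg w 0 (Reg 2)).
  apply: (eval_ev (e := Reg 2) bf); apply: leq_trans big.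
  by rewrite leq_exp2l.
- by rewrite mulnDl leq_add ?(leq_trans lt_t) // leq_pmulr // expn_gt0.
- by rewrite /= rr hmin.
- by rewrite /= rr hmax.
Qed.

(* Asymptotic comparison *)
From mathcomp Require Import all_order all_algebra.
From mathcomp Require Import all_classical all_reals all_analysis.
Import Order.TTheory GRing.Theory Num.Theory numFieldNormedType.Exports.
Local Open Scope classical_set_scope.
Local Open Scope ring_scope.

(** For [n >= 2], [n.+1 <= 2 * n] costs a factor 16 and [ln n >= ln 2] turns the logarithm into
    slack, whence the constant [K * 16 / ln 2]. *)
Lemma quartic_bigO (R : realType) (K : nat) :
  (fun n : nat => (K * n.+1 ^ 4)%N%:R : R) =O_\oo
  (fun n : nat => n%:R ^+ 4 * ln (n%:R : R)).
Proof.
have ln2 : 0 < ln (2 : R) by rewrite ln_gt0 // ltr1n.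
apply/eqOP; near=> C; near=> n.
have n2 : (2 <= n)%N by near: n; exists 2%N.
have lnn : ln (2 : R) <= ln (n%:R : R).
  by rewrite ler_ln ?posrE ?ltr0n ?ler_nat // (leq_trans _ n2).
have C0 : K%:R * 16 / ln 2 <= C by near: C; apply: nbhs_pinfty_ge; rewrite num_real.
rewrite ger0_norm ?ler0n // ger0_norm; last first.
  by rewrite mulr_ge0 ?exprn_ge0 ?ler0n // (le_trans (ltW ln2)).
have le1 : (K * n.+1 ^ 4)%N%:R <= K%:R * 16 * n%:R ^+ 4 :> R.
  rewrite -natrX -!natrM ler_nat -mulnA leq_mul2l; apply/orP; right.
  by rewrite -[16%N]/(2 ^ 4)%N -expnMn leq_exp2r // mul2n -addnn; lia.
apply: le_trans le1 _.
rewrite (mulrC (_ * 16)) [leRHS]mulrCA ler_wpM2l ?exprn_ge0 ?ler0n //.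
apply: le_trans (_ : C * ln 2 <= _).
  by rewrite -ler_pdivrMr.
apply: ler_wpM2l lnn; apply: le_trans C0.
by rewrite divr_ge0 ?(ltW ln2) // mulr_ge0.
Unshelve. all: by end_near. Qed.

Theorem corollary5p8 :
  exists (P : cmd) (k : nat) (T : nat -> nat),
    computes_on_connected P k T vpm vp /\
    forall R : realType,
      (fun n : nat => (T n)%:R : R) =O_\oo
      (fun n : nat => n%:R ^+ 4 * ln (n%:R : R)).
Proof.
have [K [k correct]] := program_correct.
exists program, k, (fun n => K * n.+1 ^ 4)%N; split=> // R.
exact: quartic_bigO.
Qed.
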